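(* For quasi-continuous $f:[0,1]\to\mathbb{R}$, we have the following: (a) the set $C_f$ is definable using $\exists^2$, and the latter computes some $x\in C_f$; (b) there is a sequence $(O_n)_{n\in\mathbb{N}}$ of RM-open sets, definable in $\exists^2$, such that $C_f=\bigcap_{n\in\mathbb{N}}O_n$; (c) the oscillation function $\mathrm{osc}_f:[0,1]\to\mathbb{R}$ is computable in $\exists^2$; (d) the supremum $\sup_{x\in[p,q]}f(x)$ is computable in $\exists^2$ for any $p,q\in\mathbb{Q}\cap[0,1]$; (e) a modulus of continuity for $f$ is definable using $\exists^2$; (f) a modulus of quasi-continuity for $f$ is definable using $\exists^2$; (g) for quasi-continuous $\Psi:[0,1]\to\mathbb{R}^{+}$, $\exists^2$ computes a finite sub-covering of the uncountable covering $\bigcup_{x\in[0,1]}B(x,\Psi(x))$ of $[0,1]$; (h) for quasi-continuous Riemann integrable $f:[0,1]\to[0,1]$ with $\int_0^1 f(x)\,dx=0$, $\exists^2$ computes $x\in[0,1]$ such that $f(x)=0$; (i) (fundamental theorem of calculus) for quasi-continuous $f:[0,1]\to\mathbb{R}$ with $F(x):=\int_0^x f(t)\,dt$, $\exists^2$ computes $x_0\in(0,1)$ such that $F'(x_0)=f(x_0)$.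
   Context: Computability is Kleene's S1-S9 computability for total objects of finite type over $\mathbb{N}$ (metatheory ZFC). The partial relation $\{e\}(\vec\Phi)\simeq y$ ($y\in\mathbb{N}$, $\vec\Phi$ a list of finite-type objects) is inductively generated by: S1 successor $x+1$; S2 constants; S3 projection to a number argument; S4 composition $\{e_1\}(\{e_2\}(\vec\Phi),\vec\Phi)$; S5 primitive recursion; S6 permutation of arguments; S7 $\{e\}(f,x,\vec\Phi)=f(x)$ for $f\in\mathbb{N}^{\mathbb{N}}$; S8 $\{e\}(\Psi^{n+2},\vec\Phi)=\Psi(\lambda\xi^{n}.\{e_1\}(\xi,\Psi,\vec\Phi))$ when the inner function is total; S9 $\{e\}(d,\vec\Phi,\vec\Phi')=\{d\}(\vec\Phi)$. A functional is computable in $G$ if, after currying so that values are natural numbers, it equals $\lambda\vec\Phi.\{e\}(G,\vec\Phi)$ for some index $e$. ''$\exists^2$ computes / defines $Z$'' (equivalently, $Z$ is computable/definable in or using $\exists^2$) means: some functional computable in $\exists^2$ returns such a $Z$ on input the given function and the other listed data. Real numbers are represented by fast-converging Cauchy sequences of rationals (elements of $\mathbb{N}^{\mathbb{N}}$); functions $\mathbb{R}\to\mathbb{R}$ are maps on representations respecting equality of reals, and functions on $[0,1]$ are treated likewise. Subsets of $\mathbb{R}$ are given by characteristic functions, with no further data. Finite sequences are coded as usual. $\exists^2:\mathbb{N}^{\mathbb{N}}\to\{0,1\}$ satisfies $\exists^2(f)=0\leftrightarrow(\exists n)(f(n)=0)$. $B(x,r)$ is the open ball (interval) with centre $x$ and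 radius $r$. $C_f$ is the set of points where $f$ is continuous. $f:[0,1]\to\mathbb{R}$ is quasi-continuous if for every $x_0\in[0,1]$, $\epsilon>0$ and open neighbourhood $U$ of $x_0$ (relative to $[0,1]$) there is a non-empty open $G\subset U$ with $(\forall x\in G)(|f(x_0)-f(x)|<\epsilon)$. A set is RM-open if it is given by an RM-code, i.e. a sequence of rational open balls whose union is the set. Oscillation: $\mathrm{osc}_f([a,b]):=\sup_{x\in[a,b]}f(x)-\inf_{x\in[a,b]}f(x)$ (similarly on balls) and $\mathrm{osc}_f(x):=\lim_{k\to\infty}\mathrm{osc}_f(B(x,\frac1{2^k}))$. A modulus of continuity for $f$ (where $C_f\neq\emptyset$ is assumed) is $F:(\mathbb{R}\times\mathbb{N})\to\mathbb{N}$ such that for all $k\in\mathbb{N}$, $x\in C_f$, $y\in[0,1]$: $|x-y|<\frac{1}{2^{F(x,k)}}\to|f(x)-f(y)|<\frac1{2^k}$. A modulus of quasi-continuity for $f$ is $F:(\mathbb{R}\times\mathbb{N}^2)\to\mathbb{Q}^2$ such that for all $x\in[0,1]$ and $k,N\in\mathbb{N}$, writing $F(x,k,N)=(c,d)$ for the two rational components, the open interval $(c,d)$ satisfies $(c,d)\subset B(x,\frac1{2^N})$ and $(\forall y\in(c,d))(|f(x)-f(y)|<\frac1{2^k})$.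
   Formalization: Since a quasi-continuous f may be unbounded, the oscillation in (c) and supremum in (d) are computed as extended reals (a flag for infinite values, otherwise a real); in (i) f is assumed Riemann integrable so that F exists; in (f) the interval (c,d) is required to be non-empty and inside [0,1]. *)

(* Defs.v *)
From Stdlib Require Export Reals QArith Qreals List Permutation.
From Stdlib Require Import Cantor ClassicalEpsilon.
From Coquelicot Require Export Coquelicot.
Export ListNotations.
Open Scope nat_scope.

Fixpoint Tp (n : nat) : Set :=
  match n with
  | O => nat
  | S m => Tp m -> nat
  end.

Inductive obj : Set := Obj (n : nat) (x : Tp n).

Definition num (x : nat) : obj := Obj 0 x.
Definition fn (f : nat -> nat) : obj := Obj 1 f.
Definition fn2 (F : (nat -> nat) -> nat) : obj := Obj 2 F.

Definition npair (a b : nat) : nat := Cantor.to_nat (a, b).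

Fixpoint code_list (s : list nat) : nat :=
  match s with
  | [] => 0
  | a :: s' => S (npair a (code_list s'))
  end.

(** [kleene e Phi y] is Kleene's S1-S9 relation [{e}(Phi) ~ y].  An index is a natural number
    [npair i p], with [i] the number of the scheme and [p] its parameters.  The
    index of S9 records the number of arguments passed on to [{d}]. *)
Inductive kleene : nat -> list obj -> nat -> Prop :=
| S1 x Phi :
    kleene (npair 1 0) (num x :: Phi) (S x)
| S2 q Phi :
    kleene (npair 2 q) Phi q
| S3 x Phi :
    kleene (npair 3 0) (num x :: Phi) x
| S4 e1 e2 Phi z y :
    kleene e2 Phi z -> kleene e1 (num z :: Phi) y ->
    kleene (npair 4 (npair e1 e2)) Phi y
| S5_zero e1 e2 Phi y :
    kleene e1 Phi y ->
    kleene (npair 5 (npair e1 e2)) (num 0 :: Phi) y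
| S5_succ e1 e2 x Phi z y :
    kleene (npair 5 (npair e1 e2)) (num x :: Phi) z ->
    kleene e2 (num x :: num z :: Phi) y ->
    kleene (npair 5 (npair e1 e2)) (num (S x) :: Phi) y
| S6 e1 (tau : list nat) Phi y :
    Permutation tau (seq 0 (length Phi)) ->
    kleene e1 (map (fun i => nth i Phi (num 0)) tau) y ->
    kleene (npair 6 (npair e1 (code_list tau))) Phi y
| S7 f x Phi :
    kleene (npair 7 0) (fn f :: num x :: Phi) (f x)
| S8 e1 n (Psi : Tp (S (S n))) (g : Tp (S n)) Phi :
    (forall xi : Tp n,
        kleene e1 (Obj n xi :: Obj (S (S n)) Psi :: Phi) (g xi)) ->
    kleene (npair 8 e1) (Obj (S (S n)) Psi :: Phi) (Psi g)
| S9 d Phi Phi' y :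
    kleene d Phi y ->
    kleene (npair 9 (length Phi)) (num d :: Phi ++ Phi') y.

(** The functional [exists^2]. *)
Definition E2 (f : nat -> nat) : nat :=
  if excluded_middle_informative (exists n, f n = 0) then 0 else 1.

(** Every rational is [rat c] for some [c]; [npair (npair a b) d] stands for
    [(a - b) / (d + 1)]. *)
Definition rat (c : nat) : Q :=
  let (ab, d) := Cantor.of_nat c in
  let (a, b) := Cantor.of_nat ab in
  Qmake (Z.of_nat a - Z.of_nat b) (Pos.of_succ_nat d).

Definition rat_pair (c : nat) : Q * Q :=
  let (a, b) := Cantor.of_nat c in (rat a, rat b).

Open Scope R_scope.

Definition represents (alpha : nat -> nat) (x : R) : Prop :=
  (forall n i : nat,
      Rabs (Q2R (rat (alpha n)) - Q2R (rat (alpha (n + i)%nat))) < / 2 ^ n) /\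
  is_lim_seq (fun n => Q2R (rat (alpha n))) x.

(** The first entry tells finite values from [+oo] and [-oo]; for a finite
    value the remaining entries represent it as a real. *)
Definition represents_bar (beta : nat -> nat) (l : Rbar) : Prop :=
  match l with
  | Finite x => beta O = O /\ represents (fun n => beta (S n)) x
  | p_infty => beta O = 1%nat
  | m_infty => beta O = 2%nat
  end.

(** A finite sequence of reals as one element of [N^N]: entry [0] is the
    length, and entry [1 + npair i n] is the [n]-th term of the Cauchy sequence
    of the [i]-th member. *)
Definition represents_list (beta : nat -> nat) (xs : list R) : Prop :=
  beta O = length xs /\
  forall i : nat, (i < length xs)%nat ->
    represents (fun n => beta (S (npair i n))) (nth i xs 0).

Definition I01 (x : R) : Prop := 0 <= x <= 1.

(** Functions [[0,1] -> R] are total functions [R -> R] of which only the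
    values on [[0,1]] matter.  Such an [f] is given by a map [Phi] on
    representations; a [Phi] respects equality of reals and takes
    representations of points of [[0,1]] to representations of reals exactly
    when some [f] satisfies the following. *)
Definition fun_represents (Phi : (nat -> nat) -> nat -> nat) (f : R -> R) : Prop :=
  forall alpha x, I01 x -> represents alpha x -> represents (Phi alpha) (f x).

(** The bijection between [N^N -> N^N] and the objects of pure type 2. *)
Definition pure2 (Phi : (nat -> nat) -> nat -> nat) : Tp 2 :=
  fun beta : nat -> nat => Phi (fun n => beta (S n)) (beta O).

(** [{e}(exists^2, f, args) ~ y], where [f] is given by [Phi].  A functional that returns a function is
    curried: the arguments of that function are part of [args]. *)
Definition computes (e : nat) (Phi : (nat -> nat) -> nat -> nat)
    (args : list obj) (y : nat) : Prop :=
  kleene e (fn2 E2 :: fn2 (pure2 Phi) :: args) y.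

Definition is_char (X : (nat -> nat) -> nat) (A : R -> Prop) : Prop :=
  forall alpha x, represents alpha x ->
    (A x -> X alpha = 1%nat) /\ (~ A x -> X alpha = 0%nat).

Definition rel_open (A : R -> Prop) : Prop :=
  exists V : R -> Prop, open V /\ forall x, A x <-> V x /\ I01 x.

Definition quasi_continuous (f : R -> R) : Prop :=
  forall x0 eps (U : R -> Prop),
    I01 x0 -> 0 < eps -> rel_open U -> U x0 ->
    exists G : R -> Prop,
      rel_open G /\ (exists x, G x) /\ (forall x, G x -> U x) /\
      (forall x, G x -> Rabs (f x0 - f x) < eps).

(** [C_f]; continuity is that of the restriction of [f] to [[0,1]]. *)
Definition cont_set (f : R -> R) (x : R) : Prop :=
  I01 x /\ filterlim f (within I01 (locally x)) (locally (f x)).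

(** An RM-code lists (codes of) pairs of a centre and a radius. *)
Definition RM_open_set (c : nat -> nat) (x : R) : Prop :=
  exists m : nat,
    Rabs (x - Q2R (fst (rat_pair (c m)))) < Q2R (snd (rat_pair (c m))).

Definition image (f : R -> R) (D : R -> Prop) (y : R) : Prop :=
  exists x, D x /\ y = f x.

(** A quasi-continuous function may be unbounded, so suprema, infima and
    oscillations take values in the extended reals. *)
Definition osc_on (f : R -> R) (D : R -> Prop) : Rbar :=
  Rbar_minus (Lub_Rbar (image f D)) (Glb_Rbar (image f D)).

(** Convergence in the order topology of [Rbar]. *)
Definition is_lim_Rbar (u : nat -> Rbar) (l : Rbar) : Prop :=
  (forall a : R, Rbar_lt a l -> eventually (fun n => Rbar_lt a (u n))) /\
  (forall b : R, Rbar_lt l b -> eventually (fun n => Rbar_lt (u n) b)).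

Definition is_osc_at (f : R -> R) (x : R) (l : Rbar) : Prop :=
  is_lim_Rbar
    (fun k => osc_on f (fun y => I01 y /\ Rabs (y - x) < / 2 ^ k)) l.

Definition is_modulus_cont (f : R -> R) (F : R -> nat -> nat) : Prop :=
  forall (k : nat) x y, cont_set f x -> I01 y ->
    Rabs (x - y) < / 2 ^ F x k -> Rabs (f x - f y) < / 2 ^ k.

(** The interval [(c,d)] is non-empty and contained in the domain of [f]. *)
Definition is_modulus_qcont (f : R -> R) (F : R -> nat -> nat -> Q * Q) : Prop :=
  forall x (k N : nat), I01 x ->
    let c := Q2R (fst (F x k N)) in
    let d := Q2R (snd (F x k N)) in
    c < d /\
    (forall y, c < y < d -> I01 y) /\
    (forall y, c < y < d -> Rabs (y - x) < / 2 ^ N) /\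
    (forall y, c < y < d -> Rabs (f x - f y) < / 2 ^ k).

(* Main.v *)
Require Import Defs.
From Stdlib Require Import Cantor ClassicalEpsilon Arith Lia Lra.
From Stdlib Require Import FunctionalExtensionality PropExtensionality.

(** Near every point [x] a quasi-continuous [f] is within [eps] of [f x] on some
    interval, hence at some rational ([quasi_continuous_rational]).  So a bound
    on the variation of [f] over an open interval holds as soon as it holds at
    the rationals of that interval ([osc_le_iff]), and likewise for suprema
    ([Lub_rational]).  Continuity at a point, the oscillation, suprema and the
    moduli thus become arithmetical in the sequence of the values of [f] at the
    rationals, in a name of the point and in a name of [f x]; and [exists^2]
    decides arithmetical statements.

    The second half of this argument is made uniform by three notions:
    [computable] families of numbers, [arithmetical] families of propositions,
    whose truth values are computable, and [computable_real] families of reals,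
    whose left cut is arithmetical.  Each scheme of Kleene gives a closure
    property, S8 at [exists^2] is quantification over a number
    ([computable_E2]), and S9 gives unbounded search ([kleene_search]), so that
    the least solution of an arithmetical condition is computable
    ([computable_mu]).  Reals of decidable cut are closed under sums,
    differences, absolute values and suprema of sequences, and have computable
    names ([computable_name_of]).  It therefore suffices to write each object of the
    theorem as a formula; the tactic [computability] follows the formula to
    find the index.

    A point of continuity arises from nested rational intervals whose
    oscillations tend to 0 ([continuity_point_spec]).  The same point serves for
    the two statements on integrals: a non-negative function with integral 0
    vanishes where it is continuous ([RInt_zero_cont]), and the integral is
    differentiable there ([RInt_derive_cont]).  For the covering, balls centred
    at rationals already cover [[0,1]], and by compactness they do so with room
    to spare, so that for a fine enough dyadic grid one ball for each grid
    point suffices ([grid_exponent_spec]). *)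

Open Scope nat_scope.

(** * Structural rules for Kleene computations *)

Lemma map_nth_seq (X Y Z : list obj) d :
  map (fun i => nth i (X ++ Y ++ Z) d) (seq (length X) (length Y)) = Y.
Proof.
revert X; induction Y as [|y Y IH]; intros X; simpl; [reflexivity|].
f_equal.
- rewrite app_nth2, Nat.sub_diag; [reflexivity|lia].
- specialize (IH (X ++ [y])).
  rewrite length_app, Nat.add_1_r, <- app_assoc in IH; exact IH.
Qed.

(** S6 as an exchange of adjacent blocks; all rearrangements of arguments below
    are composed of such exchanges. *)
Lemma kleene_swap p a b c e : exists e', forall P A B C y,
  length P = p -> length A = a -> length B = b -> length C = c ->
  kleene e (P ++ B ++ A ++ C) y -> kleene e' (P ++ A ++ B ++ C) y.
Proof.
pose (tau := seq 0 p ++ seq (p + a) b ++ seq p a ++ seq (p + a + b) c).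
exists (npair 6 (npair e (code_list tau))).
intros P A B C y HP HA HB HC H; subst.
apply S6.
- unfold tau; rewrite !length_app, !Nat.add_assoc, !seq_app; simpl.
  rewrite <- !app_assoc; apply Permutation_app_head.
  rewrite !app_assoc; apply Permutation_app_tail, Permutation_app_comm.
- assert (E : map (fun i => nth i (P ++ A ++ B ++ C) (num 0)) tau = P ++ B ++ A ++ C).
  { unfold tau; rewrite !map_app; repeat f_equal.
    - exact (map_nth_seq [] P (A ++ B ++ C) (num 0)).
    - pose proof (map_nth_seq (P ++ A) B C (num 0)) as E.
      rewrite length_app, <- app_assoc in E; exact E.
    - exact (map_nth_seq P A (B ++ C) (num 0)).
    - pose proof (map_nth_seq (P ++ A ++ B) C [] (num 0)) as E.
      rewrite !length_app, app_nil_r, <- !app_assoc, Nat.add_assoc in E; exact E. }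
  rewrite E; exact H.
Qed.

(** S9 is the scheme that discards arguments: it runs an index on a prefix of the
    argument list. *)
Lemma kleene_prefix j e : exists e', forall L M y,
  length L = j -> kleene e L y -> kleene e' (L ++ M) y.
Proof.
exists (npair 4 (npair (npair 9 j) (npair 2 e))).
intros L M y <- H; eapply S4; [apply S2|apply S9, H].
Qed.

Definition operator := (nat -> nat) -> nat -> nat.

Definition base (b : bool) (Phi : operator) (al : nat -> nat) : list obj :=
  fn2 E2 :: fn2 (pure2 Phi) :: if b then [fn al] else [].

(** One index serves all operators [Phi], all sequences [al] and all lists of
    [k] numbers.  The numbers come first because S1, S3, S4 and S5 act at the
    head of the argument list; [b] tells whether [al] is an argument. *)
Definition computable (b : bool) (k : nat)
    (F : operator -> (nat -> nat) -> list nat -> nat) : Prop :=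
  exists e, forall Phi al ns, length ns = k ->
    kleene e (map num ns ++ base b Phi al) (F Phi al ns).

Definition base_length (b : bool) : nat := if b then 3 else 2.

Lemma length_base b Phi al : length (base b Phi al) = base_length b.
Proof. destruct b; reflexivity. Qed.

Lemma computable_ext b k F G :
  computable b k F ->
  (forall Phi al ns, length ns = k -> F Phi al ns = G Phi al ns) ->
  computable b k G.
Proof. intros [e H] E; exists e; intros; rewrite <- E; auto. Qed.

Lemma computable_top b k F :
  computable b k F ->
  exists e, forall Phi al ns, length ns = k ->
    kleene e (base b Phi al ++ map num ns) (F Phi al ns).
Proof.
intros [e H].
destruct (kleene_swap 0 (base_length b) k 0 e) as [e' H'].
exists e'; intros Phi al ns Hn.
specialize (H' [] (base b Phi al) (map num ns) [] (F Phi al ns)).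
rewrite !app_nil_r in H'; apply H';
  rewrite ?length_map, ?length_base; try apply H; auto.
Qed.

Lemma computable_weak_at p b k F :
  computable b (p + k) F ->
  computable b (p + S k) (fun Phi al ns => F Phi al (firstn p ns ++ skipn (S p) ns)).
Proof.
intros [e H].
destruct (kleene_prefix (p + k + base_length b) e) as [e1 H1].
destruct (kleene_swap p 1 (k + base_length b) 0 e1) as [e2 H2].
exists e2; intros Phi al ns Hn.
assert (E : map num ns ++ base b Phi al =
  map num (firstn p ns) ++ [num (nth p ns 0)] ++
  (map num (skipn (S p) ns) ++ base b Phi al) ++ []).
{ rewrite app_nil_r, !app_assoc; f_equal.
  transitivity (map num (firstn p ns ++ nth p ns 0 :: skipn (S p) ns)).
  - f_equal. clear - Hn. revert ns Hn; induction p; intros [|n ns] Hn; simpl in *; try lia; auto.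
    f_equal; apply IHp; lia.
  - rewrite map_app, <- app_assoc; reflexivity. }
rewrite E; apply H2;
  rewrite ?length_app, ?length_map, ?length_base, ?length_firstn, ?length_skipn;
  try lia; try reflexivity.
cbn [app].
rewrite !app_assoc; apply H1.
- rewrite ?length_app, ?length_map, ?length_base, ?length_firstn, ?length_skipn; lia.
- rewrite <- map_app; apply H.
  rewrite length_app, length_firstn, length_skipn; lia.
Qed.

Lemma computable_weak b k F :
  computable b k F -> computable b (S k) (fun Phi al ns => F Phi al (tl ns)).
Proof.
intros H; apply (computable_weak_at 0) in H; eapply computable_ext; [exact H|].
intros Phi al [|n ns]; reflexivity.
Qed.

Lemma computable_weak1 b k F :
  computable b (S k) F ->
  computable b (S (S k)) (fun Phi al ns => F Phi al (hd 0 ns :: tl (tl ns))).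
Proof.
intros H; apply (computable_weak_at 1) in H; eapply computable_ext; [exact H|].
intros Phi al [|n [|m ns]]; simpl; try discriminate; reflexivity.
Qed.

(** A function of [j] numbers can be called in any larger context. *)
Lemma computable_prefix b j k F :
  computable b j F -> computable b (j + k) (fun Phi al ns => F Phi al (firstn j ns)).
Proof.
intros H; induction k as [|k IH].
- rewrite Nat.add_0_r; eapply computable_ext; [exact H|].
  intros Phi al ns <-; rewrite firstn_all; reflexivity.
- apply computable_weak_at in IH; eapply computable_ext; [exact IH|].
  intros Phi al ns Hn; simpl; f_equal.
  rewrite firstn_app, firstn_firstn, Nat.min_id, length_firstn.
  replace (j - min j (length ns)) with 0 by lia.
  rewrite firstn_O, app_nil_r; reflexivity.
Qed.

(** * The schemes as closure properties *)

Lemma computable_push b k G A :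
  computable b (S k) G -> computable b k A ->
  computable b k (fun Phi al ns => G Phi al (A Phi al ns :: ns)).
Proof.
intros [e He] [d Hd]; exists (npair 4 (npair e d)); intros Phi al ns Hn.
eapply S4; [apply Hd, Hn|].
exact (He Phi al (A Phi al ns :: ns) (f_equal S Hn)).
Qed.

Lemma computable_const b k c : computable b k (fun _ _ _ => c).
Proof. exists (npair 2 c); intros; apply S2. Qed.

Lemma computable_var0 b k : computable b (S k) (fun _ _ ns => hd 0 ns).
Proof. exists (npair 3 0); intros Phi al [|n ns] Hn; [discriminate|apply S3]. Qed.

Definition computable_var1 b k := computable_weak b _ _ (computable_var0 b k).
Definition computable_var2 b k := computable_weak b _ _ (computable_var1 b k).
Definition computable_var3 b k := computable_weak b _ _ (computable_var2 b k).
Definition computable_var4 b k := computable_weak b _ _ (computable_var3 b k).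

Lemma computable_app1 b k (g : operator -> nat -> nat) A :
  computable b 1 (fun Phi _ ns => g Phi (hd 0 ns)) -> computable b k A ->
  computable b k (fun Phi al ns => g Phi (A Phi al ns)).
Proof.
intros Hg HA.
exact (computable_push _ _ _ _ (computable_prefix b 1 k _ Hg) HA).
Qed.

Lemma computable_succ b k A :
  computable b k A -> computable b k (fun Phi al ns => S (A Phi al ns)).
Proof.
intros HA; apply (computable_app1 b k (fun _ n => S n)); [|exact HA].
exists (npair 1 0); intros Phi al [|n ns] Hn; [discriminate|apply S1].
Qed.

Lemma computable_rect b k A N B :
  computable b k N -> computable b k A ->
  computable b (S (S k))
    (fun Phi al ns => B Phi al (tl (tl ns)) (hd 0 ns) (hd 0 (tl ns))) ->
  computable b k (fun Phi al ns =>
    nat_rect (fun _ => nat) (A Phi al ns) (fun x z => B Phi al ns x z) (N Phi al ns)).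
Proof.
intros HN [e He] [d Hd].
refine (computable_push b k (fun Phi al ns => nat_rect (fun _ => nat) (A Phi al (tl ns))
  (fun x z => B Phi al (tl ns) x z) (hd 0 ns)) N _ HN).
exists (npair 5 (npair e d)); intros Phi al [|n ns] Hn; [discriminate|].
injection Hn as Hn; simpl; induction n as [|n IH]; simpl.
- apply S5_zero, He, Hn.
- eapply S5_succ; [exact IH|].
  refine (Hd Phi al (_ :: _ :: ns) _); simpl; lia.
Qed.

Lemma computable_case b k A N B :
  computable b k N -> computable b k A ->
  computable b (S k) (fun Phi al ns => B Phi al (tl ns) (hd 0 ns)) ->
  computable b k (fun Phi al ns =>
    match N Phi al ns with 0 => A Phi al ns | S x => B Phi al ns x end).
Proof.
intros HN HA HB.
refine (computable_ext _ _ _ _ (computable_rect b k A N (fun Phi al ns x _ => B Phi al ns x)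
  HN HA (computable_weak1 _ _ _ HB)) _).
intros; destruct (N Phi al ns); reflexivity.
Qed.

(** [S8] with [exists^2] is quantification over a number. *)
Lemma computable_E2 b k F :
  computable b (S k) (fun Phi al ns => F Phi al (tl ns) (hd 0 ns)) ->
  computable b k (fun Phi al ns => E2 (fun n => F Phi al ns n)).
Proof.
intros [e H].
pose (r := pred (base_length b)).
destruct (kleene_swap 1 1 k r e) as [e1 H1].
destruct (kleene_swap 0 k 1 r (npair 8 e1)) as [e2 H2].
exists e2; intros Phi al ns Hn.
pose (T := fn2 (pure2 Phi) :: if b then [fn al] else []).
assert (HT : length T = r) by (destruct b; reflexivity).
apply (H2 [] (map num ns) [fn2 E2] T); rewrite ?length_map; auto.
apply (S8 e1 0 E2); intros n.
apply (H1 [num n] [fn2 E2] (map num ns) T); rewrite ?length_map; auto.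
exact (H Phi al (n :: ns) (f_equal S Hn)).
Qed.

(** [S8] with the given operator; the functional [pure2 Phi] takes the two
    arguments of [Phi] as one sequence, whose head is the number. *)
Lemma computable_operator b k F M :
  computable b (S k) (fun Phi al ns => F Phi al (tl ns) (hd 0 ns)) ->
  computable b k M ->
  computable b k (fun Phi al ns => Phi (fun n => F Phi al ns n) (M Phi al ns)).
Proof.
intros HF HM.
destruct (computable_case b (S k) (fun Phi al ns => M Phi al (tl ns))
  (fun _ _ ns => hd 0 ns) (fun Phi al ns x => F Phi al (tl ns) x)) as [e H].
{ apply computable_var0. }
{ apply computable_weak, HM. }
{ exact (computable_weak1 _ _ _ HF). }
pose (r := pred (pred (base_length b))).
destruct (kleene_swap 1 1 (k + 1) r e) as [e1 H1].
destruct (kleene_swap 0 (k + 1) 1 r (npair 8 e1)) as [e2 H2].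
exists e2; intros Phi al ns Hn.
pose (T := if b then [fn al] else []).
assert (HT : length T = r) by (destruct b; reflexivity).
assert (L : length (map num ns ++ [fn2 E2]) = k + 1)
  by (rewrite length_app, length_map, Hn; reflexivity).
specialize (H2 [] (map num ns ++ [fn2 E2]) [fn2 (pure2 Phi)] T).
cbn [app] in H2; rewrite <- !app_assoc in H2; apply H2; auto.
apply (S8 e1 0 (pure2 Phi)
  (fun x => match x with 0 => M Phi al ns | S n => F Phi al ns n end)); intros n.
specialize (H1 [num n] [fn2 (pure2 Phi)] (map num ns ++ [fn2 E2]) T).
cbn [app] in H1; rewrite <- !app_assoc in H1; apply H1; auto.
  exact (H Phi al (n :: ns) (f_equal S Hn)).
Qed.

Lemma computable_oracle k N :
  computable true k N -> computable true k (fun Phi al ns => al (N Phi al ns)).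
Proof.
intros HN.
refine (computable_push true k (fun Phi al ns => al (hd 0 ns)) N _ HN).
destruct (kleene_swap 0 (k + 3) 1 0 (npair 7 0)) as [e H].
exists e; intros Phi al [|n ns] Hn; [discriminate|].
specialize (H [] (map num (n :: ns) ++ [fn2 E2; fn2 (pure2 Phi)]) [fn al] []).
cbn [app] in H; rewrite <- !app_assoc in H; apply H; auto.
- rewrite length_app, length_map, Hn; simpl; lia.
- apply S7.
Qed.

(** * Unbounded search *)

(** Truth is 0, as in the values of [exists^2]. *)
Definition ind (P : Prop) : nat := if excluded_middle_informative P then 0 else 1.

Lemma ind_true (P : Prop) : P -> ind P = 0.
Proof. intros H; unfold ind; destruct excluded_middle_informative; tauto. Qed.

Lemma ind_false (P : Prop) : ~ P -> ind P = 1.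
Proof. intros H; unfold ind; destruct excluded_middle_informative; tauto. Qed.

(** The searching index receives itself as its first argument and calls that
    argument by S9, which gives unbounded recursion.  Stopping and going on
    are separated by S5, whose step is run only when the recursion argument is
    positive; so the computation is defined once some number satisfies [P]. *)
Lemma kleene_search b k P :
  computable b (S k) (fun Phi al ns => ind (P Phi al (tl ns) (hd 0 ns))) ->
  exists e, forall Phi al ns m n, length ns = k ->
    P Phi al ns (m + n) -> (forall i, i < m -> ~ P Phi al ns (i + n)) ->
    kleene e (num e :: num n :: map num ns ++ base b Phi al) (m + n).
Proof.
intros Ht.
destruct (computable_weak _ _ _ Ht) as [t Ht'].
destruct (computable_var1 b k) as [v1 Hv1].
(* the step of S5 sees the numbers [0 :: z :: self :: n :: ns], where [z] is
     the value of the recursion at 0 *)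
destruct (computable_succ _ _ _ (computable_var3 b k)) as [s Hs].
destruct (computable_var3 b (S k)) as [v3 Hv3].
destruct (computable_var4 b (S k)) as [v4 Hv4].
destruct (kleene_swap 3 4 (k + base_length b) 0
  (npair 9 (2 + (k + base_length b)))) as [c Hc].
pose (step := npair 4 (npair (npair 4 (npair (npair 4 (npair c v4)) v3)) s)).
exists (npair 4 (npair (npair 5 (npair v1 step)) t)).
set (e := npair 4 _).
intros Phi al ns m n Hn; revert n; induction m as [|m IH]; intros n Hm Hlt.
- eapply S4; [refine (Ht' Phi al (_ :: _ :: ns) _); simpl; lia|].
  simpl in *; rewrite ind_true by exact Hm.
  apply S5_zero; refine (Hv1 Phi al (_ :: _ :: ns) _); simpl; lia.
- eapply S4; [refine (Ht' Phi al (_ :: _ :: ns) _); simpl; lia|].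
  simpl in *; rewrite ind_false by exact (Hlt 0 (Nat.lt_0_succ m)).
  eapply S5_succ.
  { apply S5_zero; refine (Hv1 Phi al (_ :: _ :: ns) _); simpl; lia. }
  eapply S4; [refine (Hs Phi al (_ :: _ :: _ :: _ :: ns) _); simpl; lia|].
  eapply S4; [refine (Hv3 Phi al (_ :: _ :: _ :: _ :: _ :: ns) _); simpl; lia|].
  eapply S4; [refine (Hv4 Phi al (_ :: _ :: _ :: _ :: _ :: _ :: ns) _); simpl; lia|].
  simpl.
  pose proof (S9 e (num e :: num (S n) :: map num ns ++ base b Phi al)
    [num 0; num n; num e; num n] (S m + n)) as H9.
  simpl length in H9; rewrite length_app, length_map, length_base, Hn in H9.
  specialize (Hc [num e; num e; num (S n)] [num 0; num n; num e; num n]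
    (map num ns ++ base b Phi al) [] (S m + n)).
  rewrite !app_nil_r in Hc; apply Hc; try reflexivity.
  + rewrite length_app, length_map, length_base, Hn; reflexivity.
  + apply H9; replace (S m + n) with (m + S n) by lia; apply IH.
    * replace (m + S n) with (S (m + n)) by lia; exact Hm.
    * intros i Hi; replace (i + S n) with (S i + n) by lia; apply Hlt; lia.
Qed.

(** A predicate without witnesses gets the value 0. *)
Definition mu (P : nat -> Prop) : nat :=
  epsilon (inhabits 0) (fun n =>
    (P n \/ ~ (exists m, P m)) /\ forall i, i < n -> ~ (P i \/ ~ (exists m, P m))).

Lemma mu_least (P : nat -> Prop) :
  (P (mu P) \/ ~ (exists m, P m)) /\
  forall i, i < mu P -> ~ (P i \/ ~ (exists m, P m)).
Proof.
unfold mu; apply epsilon_spec.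
set (Q := fun n => P n \/ ~ (exists m, P m)).
assert (HQ : exists n, Q n).
{ destruct (excluded_middle_informative (exists m, P m)) as [[m Hm]|H].
  - exists m; left; exact Hm.
  - exists 0; right; exact H. }
destruct HQ as [n Hn]; revert Hn.
induction n as [n IH] using lt_wf_ind; intros Hn.
destruct (excluded_middle_informative (exists i, i < n /\ Q i)) as [(i & Hi & Hq)|H].
- exact (IH i Hi Hq).
- exists n; split; [exact Hn|]; intros i Hi Hq; apply H; exists i; split; assumption.
Qed.

Lemma mu_spec (P : nat -> Prop) : (exists n, P n) -> P (mu P).
Proof. intros H; destruct (mu_least P) as [[Hm|Hm] _]; [exact Hm|contradiction]. Qed.

Lemma mu_ext (P Q : nat -> Prop) : (forall n, P n <-> Q n) -> mu P = mu Q.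
Proof.
intros H; replace Q with P; [reflexivity|].
apply functional_extensionality; intros n; apply propositional_extensionality, H.
Qed.

(** * Predicates decidable in [exists^2] *)

Definition arithmetical (b : bool) (k : nat)
    (P : operator -> (nat -> nat) -> list nat -> Prop) : Prop :=
  computable b k (fun Phi al ns => ind (P Phi al ns)).

Lemma arithmetical_ext b k P Q :
  arithmetical b k P ->
  (forall Phi al ns, length ns = k -> P Phi al ns <-> Q Phi al ns) ->
  arithmetical b k Q.
Proof.
intros H E; eapply computable_ext; [exact H|]; intros Phi al ns Hn; simpl.
f_equal; apply propositional_extensionality; auto.
Qed.

Lemma arithmetical_zero b k A :
  computable b k A -> arithmetical b k (fun Phi al ns => A Phi al ns = 0).
Proof.
intros H; eapply computable_ext;
  [exact (computable_case b k (fun _ _ _ => 0) A (fun _ _ _ _ => 1) H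
    (computable_const _ _ _) (computable_const _ _ _))|].
intros Phi al ns Hn; simpl; destruct (A Phi al ns); symmetry;
  [apply ind_true|apply ind_false]; auto.
Qed.

Lemma arithmetical_not b k P :
  arithmetical b k P -> arithmetical b k (fun Phi al ns => ~ P Phi al ns).
Proof.
intros H; eapply computable_ext;
  [exact (computable_case b k (fun _ _ _ => 1) _ (fun _ _ _ _ => 0) H
    (computable_const _ _ _) (computable_const _ _ _))|].
intros Phi al ns Hn; simpl; unfold ind; repeat destruct excluded_middle_informative; tauto.
Qed.

Lemma computable_ite b k P A B :
  arithmetical b k P -> computable b k A -> computable b k B ->
  computable b k (fun Phi al ns =>
    if excluded_middle_informative (P Phi al ns) then A Phi al ns else B Phi al ns).
Proof.
intros HP HA HB; eapply computable_ext;
  [exact (computable_case b k A _ (fun Phi al ns _ => B Phi al ns) HP HA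
    (computable_weak _ _ _ HB))|].
intros Phi al ns Hn; simpl; unfold ind; destruct excluded_middle_informative; auto.
Qed.

Lemma arithmetical_and b k P Q :
  arithmetical b k P -> arithmetical b k Q ->
  arithmetical b k (fun Phi al ns => P Phi al ns /\ Q Phi al ns).
Proof.
intros HP HQ; eapply computable_ext;
  [exact (computable_ite b k P _ (fun _ _ _ => 1) HP HQ (computable_const _ _ _))|].
intros Phi al ns Hn; simpl; unfold ind; repeat destruct excluded_middle_informative; tauto.
Qed.

Lemma arithmetical_imp b k P Q :
  arithmetical b k P -> arithmetical b k Q ->
  arithmetical b k (fun Phi al ns => P Phi al ns -> Q Phi al ns).
Proof.
intros HP HQ; eapply computable_ext;
  [exact (computable_ite b k P _ (fun _ _ _ => 0) HP HQ (computable_const _ _ _))|].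
intros Phi al ns Hn; simpl; unfold ind; repeat destruct excluded_middle_informative; tauto.
Qed.

Lemma arithmetical_or b k P Q :
  arithmetical b k P -> arithmetical b k Q ->
  arithmetical b k (fun Phi al ns => P Phi al ns \/ Q Phi al ns).
Proof.
intros HP HQ; eapply arithmetical_ext;
  [exact (arithmetical_imp _ _ _ _ (arithmetical_not _ _ _ HP) HQ)|].
intros Phi al ns Hn; simpl; destruct (excluded_middle_informative (P Phi al ns)); tauto.
Qed.

(** Since truth is 0, [exists^2] applied to the truth values of [P] is the truth
    value of the quantified statement. *)
Lemma arithmetical_exists b k P :
  arithmetical b (S k) (fun Phi al ns => P Phi al (tl ns) (hd 0 ns)) ->
  arithmetical b k (fun Phi al ns => exists n, P Phi al ns n).
Proof.
intros HP; eapply computable_ext;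
  [exact (computable_E2 b k (fun Phi al ns n => ind (P Phi al ns n)) HP)|].
intros Phi al ns Hn; simpl; unfold E2.
assert (E : (exists n, ind (P Phi al ns n) = 0) <-> exists n, P Phi al ns n).
{ split; intros [n H]; exists n; [|apply ind_true, H].
  unfold ind in H; destruct excluded_middle_informative; [assumption|discriminate]. }
destruct excluded_middle_informative; symmetry; [apply ind_true|apply ind_false]; tauto.
Qed.

Lemma arithmetical_forall b k P :
  arithmetical b (S k) (fun Phi al ns => P Phi al (tl ns) (hd 0 ns)) ->
  arithmetical b k (fun Phi al ns => forall n, P Phi al ns n).
Proof.
intros HP; eapply arithmetical_ext;
  [exact (arithmetical_not _ _ _ (arithmetical_exists b k
    (fun Phi al ns n => ~ P Phi al ns n) (arithmetical_not _ _ _ HP)))|].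
intros Phi al ns Hn; simpl; split.
- intros H n; destruct (excluded_middle_informative (P Phi al ns n)) as [|N];
    [assumption|destruct H; exists n; exact N].
- intros H [n N]; exact (N (H n)).
Qed.

(** Search is made total by letting every number count as a solution when [P]
    has no witness, which is itself an arithmetical condition. *)
Lemma computable_mu b k P :
  arithmetical b (S k) (fun Phi al ns => P Phi al (tl ns) (hd 0 ns)) ->
  computable b k (fun Phi al ns => mu (fun n => P Phi al ns n)).
Proof.
intros HP.
destruct (kleene_search b k (fun Phi al ns n =>
  P Phi al ns n \/ ~ exists m, P Phi al ns m)) as [e He].
{ exact (arithmetical_or _ _ _ _ HP (arithmetical_not _ _ _
    (computable_weak _ _ _ (arithmetical_exists _ _ _ HP)))). }
exists (npair 4 (npair (npair 4 (npair e (npair 2 e))) (npair 2 0))).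
intros Phi al ns Hn; eapply S4; [apply S2|eapply S4; [apply S2|]].
destruct (mu_least (P Phi al ns)) as [H1 H2].
replace (mu _) with (mu (P Phi al ns) + 0) by apply Nat.add_0_r.
apply He; [exact Hn|rewrite Nat.add_0_r; exact H1|].
intros i Hi; rewrite Nat.add_0_r; exact (H2 i Hi).
Qed.

(** * Arithmetic *)

Lemma computable_add b k A B :
  computable b k A -> computable b k B ->
  computable b k (fun Phi al ns => A Phi al ns + B Phi al ns).
Proof.
intros HA HB; eapply computable_ext;
  [exact (computable_rect b k B A (fun _ _ _ _ z => S z) HA HB
    (computable_succ _ _ _ (computable_var1 _ _)))|].
intros Phi al ns _; simpl; induction (A Phi al ns); simpl; auto.
Qed.

Lemma computable_mul b k A B :
  computable b k A -> computable b k B ->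
  computable b k (fun Phi al ns => A Phi al ns * B Phi al ns).
Proof.
intros HA HB; eapply computable_ext;
  [exact (computable_rect b k (fun _ _ _ => 0) A (fun Phi al ns _ z => B Phi al ns + z) HA
    (computable_const _ _ _)
    (computable_add _ _ _ _ (computable_weak _ _ _ (computable_weak _ _ _ HB))
      (computable_var1 _ _)))|].
intros Phi al ns _; simpl; induction (A Phi al ns); simpl; auto.
Qed.

Lemma computable_pred b k A :
  computable b k A -> computable b k (fun Phi al ns => pred (A Phi al ns)).
Proof.
intros HA; eapply computable_ext;
  [exact (computable_case b k (fun _ _ _ => 0) A (fun _ _ _ x => x) HA
    (computable_const _ _ _) (computable_var0 _ _))|].
intros Phi al ns _; simpl; destruct (A Phi al ns); reflexivity.
Qed.

Lemma computable_sub b k A B :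
  computable b k A -> computable b k B ->
  computable b k (fun Phi al ns => A Phi al ns - B Phi al ns).
Proof.
intros HA HB; eapply computable_ext;
  [exact (computable_rect b k A B (fun _ _ _ _ z => pred z) HB HA
    (computable_pred _ _ _ (computable_var1 _ _)))|].
intros Phi al ns _; simpl; induction (B Phi al ns); simpl; lia.
Qed.

Lemma computable_pow2 b k A :
  computable b k A -> computable b k (fun Phi al ns => 2 ^ A Phi al ns).
Proof.
intros HA; eapply computable_ext;
  [exact (computable_rect b k (fun _ _ _ => 1) A (fun _ _ _ _ z => 2 * z) HA
    (computable_const _ _ _)
    (computable_mul _ _ _ _ (computable_const _ _ _) (computable_var1 _ _)))|].
intros Phi al ns _; simpl; induction (A Phi al ns); simpl; auto.
Qed.

Lemma arithmetical_le b k A B :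
  computable b k A -> computable b k B ->
  arithmetical b k (fun Phi al ns => A Phi al ns <= B Phi al ns).
Proof.
intros HA HB; eapply arithmetical_ext;
  [exact (arithmetical_zero _ _ _ (computable_sub _ _ _ _ HA HB))|].
intros; simpl; lia.
Qed.

Lemma arithmetical_eq b k A B :
  computable b k A -> computable b k B ->
  arithmetical b k (fun Phi al ns => A Phi al ns = B Phi al ns).
Proof.
intros HA HB; eapply arithmetical_ext;
  [exact (arithmetical_and _ _ _ _ (arithmetical_le _ _ _ _ HA HB)
    (arithmetical_le _ _ _ _ HB HA))|].
intros; simpl; lia.
Qed.

(** * Pairing *)

Lemma computable_npair b k A B :
  computable b k A -> computable b k B ->
  computable b k (fun Phi al ns => npair (A Phi al ns) (B Phi al ns)).
Proof.
intros HA HB; exact (computable_add _ _ _ _ HB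
  (computable_rect b k (fun _ _ _ => 0) (fun Phi al ns => B Phi al ns + A Phi al ns)
    (fun _ _ _ i m => S i + m) (computable_add _ _ _ _ HB HA) (computable_const _ _ _)
    (computable_add _ _ _ _ (computable_succ _ _ _ (computable_var0 _ _))
      (computable_var1 _ _)))).
Qed.

Definition code_fst (c : nat) : nat := fst (Cantor.of_nat c).
Definition code_snd (c : nat) : nat := snd (Cantor.of_nat c).

Lemma code_fst_npair a b : code_fst (npair a b) = a.
Proof. unfold code_fst, npair; rewrite Cantor.cancel_of_to; reflexivity. Qed.

Lemma code_snd_npair a b : code_snd (npair a b) = b.
Proof. unfold code_snd, npair; rewrite Cantor.cancel_of_to; reflexivity. Qed.

Lemma npair_eta c : npair (code_fst c) (code_snd c) = c.
Proof.
unfold code_fst, code_snd, npair; rewrite <- surjective_pairing; apply Cantor.cancel_to_of.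
Qed.

(** Projections are found by search, as the solutions of the equation
    [npair m n = c]. *)
Lemma computable_code_fst b k A :
  computable b k A -> computable b k (fun Phi al ns => code_fst (A Phi al ns)).
Proof.
intros HA; eapply computable_ext;
  [apply (computable_mu b k (fun Phi al ns m => exists n, npair m n = A Phi al ns));
   apply (arithmetical_exists _ _ (fun Phi al ns n => npair (hd 0 ns) n = A Phi al (tl ns)));
   apply arithmetical_eq; [apply computable_npair|];
   [exact (computable_var1 _ _)|exact (computable_var0 _ _)|
    exact (computable_weak _ _ _ (computable_weak _ _ _ HA))]|].
intros Phi al ns _; simpl; set (c := A Phi al ns).
destruct (mu_spec (fun m => exists n, npair m n = c)) as [n Hn].
- exists (code_fst c), (code_snd c); apply npair_eta.
- apply (f_equal code_fst) in Hn; rewrite code_fst_npair in Hn; exact Hn.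
Qed.

Lemma computable_code_snd b k A :
  computable b k A -> computable b k (fun Phi al ns => code_snd (A Phi al ns)).
Proof.
intros HA; eapply computable_ext;
  [apply (computable_mu b k (fun Phi al ns n => npair (code_fst (A Phi al ns)) n = A Phi al ns));
   apply arithmetical_eq; [apply computable_npair; [apply computable_code_fst|]|];
   try exact (computable_var0 _ _); exact (computable_weak _ _ _ HA)|].
intros Phi al ns _; simpl; set (c := A Phi al ns).
assert (H := mu_spec (fun n => npair (code_fst c) n = c)
  (ex_intro _ (code_snd c) (npair_eta c))).
apply (f_equal code_snd) in H; rewrite code_snd_npair in H; exact H.
Qed.

(** * Rational numbers *)

Open Scope R_scope.

Definition q2 (c : nat) : R := Q2R (rat c).

Definition fraction (a b d : nat) : nat := npair (npair a b) d.
Definition numer_pos (c : nat) : nat := code_fst (code_fst c).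
Definition numer_neg (c : nat) : nat := code_snd (code_fst c).
Definition denom (c : nat) : nat := S (code_snd c).

Lemma q2_components c :
  q2 c = (INR (numer_pos c) - INR (numer_neg c)) / INR (denom c).
Proof.
unfold q2, rat, numer_pos, numer_neg, denom, code_fst, code_snd.
destruct (Cantor.of_nat c) as [ab d]; simpl fst; simpl snd.
destruct (Cantor.of_nat ab) as [a b]; simpl fst; simpl snd.
unfold Q2R; simpl Qnum; simpl Qden.
rewrite minus_IZR, !INR_IZR_INZ; unfold Rdiv.
do 2 f_equal; apply (f_equal IZR); lia.
Qed.

Lemma q2_fraction a b d : q2 (fraction a b d) = (INR a - INR b) / INR (S d).
Proof.
rewrite q2_components; unfold numer_pos, numer_neg, denom, fraction.
rewrite !code_fst_npair, !code_snd_npair; reflexivity.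
Qed.

Lemma denom_pos c : 0 < INR (denom c).
Proof. apply lt_0_INR; unfold denom; lia. Qed.

Definition radd (c d : nat) : nat :=
  fraction (numer_pos c * denom d + numer_pos d * denom c)
           (numer_neg c * denom d + numer_neg d * denom c)
           (pred (denom c * denom d)).

Definition ropp (c : nat) : nat := fraction (numer_neg c) (numer_pos c) (code_snd c).

Definition dyadic (j m : nat) : nat := fraction j 0 (pred (2 ^ m)).

Lemma q2_radd c d : q2 (radd c d) = q2 c + q2 d.
Proof.
unfold radd; rewrite q2_fraction, Nat.succ_pred by (unfold denom; lia).
rewrite !q2_components, !plus_INR, !mult_INR.
pose proof (denom_pos c); pose proof (denom_pos d); field; lra.
Qed.

Lemma q2_ropp c : q2 (ropp c) = - q2 c.
Proof.
unfold ropp; rewrite q2_fraction, q2_components; fold (denom c).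
pose proof (denom_pos c); field; lra.
Qed.

Lemma pow2_pos n : 0 < 2 ^ n.
Proof. apply pow_lt; lra. Qed.

Lemma inv_pow2_pos n : 0 < / 2 ^ n.
Proof. apply Rinv_0_lt_compat, pow2_pos. Qed.

Lemma inv_pow2_S n : / 2 ^ S n = / 2 ^ n / 2.
Proof. simpl; pose proof (pow2_pos n); field; lra. Qed.

Lemma q2_dyadic j m : q2 (dyadic j m) = INR j * / 2 ^ m.
Proof.
unfold dyadic; rewrite q2_fraction, Nat.succ_pred by (apply Nat.pow_nonzero; lia).
rewrite pow_INR; replace (INR 2) with 2 by (simpl; lra).
simpl (INR 0); unfold Rdiv; ring.
Qed.

Lemma q2_lt c d : q2 c < q2 d <->
  (S (numer_pos c * denom d + numer_neg d * denom c)
   <= numer_pos d * denom c + numer_neg c * denom d)%nat.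
Proof.
rewrite !q2_components.
pose proof (denom_pos c) as Hc; pose proof (denom_pos d) as Hd.
transitivity ((INR (numer_pos c) - INR (numer_neg c)) * INR (denom d) <
  (INR (numer_pos d) - INR (numer_neg d)) * INR (denom c)).
{ split; intros H.
  - apply (Rmult_lt_compat_r (INR (denom c) * INR (denom d))) in H; [|nra].
    field_simplify in H; lra.
  - apply (Rmult_lt_reg_r (INR (denom c) * INR (denom d))); [nra|].
    field_simplify; lra. }
fold (lt (numer_pos c * denom d + numer_neg d * denom c)
         (numer_pos d * denom c + numer_neg c * denom d)).
split; intros H.
- apply INR_lt; rewrite !plus_INR, !mult_INR; lra.
- apply lt_INR in H; rewrite !plus_INR, !mult_INR in H; lra.
Qed.

Lemma q2_dense x y : x < y -> exists c, x < q2 c < y.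
Proof.
intros Hxy.
destruct (archimed_cor1 (y - x)) as (n & Hn & Hn0); [lra|].
assert (Hp : 0 < INR n) by (apply lt_0_INR; lia).
destruct (archimed (x * INR n)) as [H1 H2].
set (z := up (x * INR n)) in *.
exists (fraction (Z.to_nat z) (Z.to_nat (- z)) (pred n)).
rewrite q2_fraction, Nat.succ_pred by lia.
replace (INR (Z.to_nat z) - INR (Z.to_nat (- z))) with (IZR z)
  by (rewrite !INR_IZR_INZ, <- minus_IZR; f_equal; lia).
assert (Hy : 1 < (y - x) * INR n).
{ apply (Rmult_lt_compat_r (INR n)) in Hn; [|assumption].
  rewrite Rinv_l in Hn; lra. }
split; apply (Rmult_lt_reg_r (INR n)); try assumption; unfold Rdiv;
  rewrite ?Rmult_assoc, ?Rinv_l, ?Rmult_1_r by lra; lra.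
Qed.

(** * Real numbers with a decidable left cut *)

(** A left cut is preferred to a Cauchy name: it depends on the real only, and
    the cut of a supremum is a quantification over cuts. *)
Definition computable_real (b : bool) (k : nat)
    (X : operator -> (nat -> nat) -> list nat -> R) : Prop :=
  arithmetical b (S k) (fun Phi al ns => q2 (hd 0%nat ns) < X Phi al (tl ns)).

Lemma computable_real_ext b k X Y :
  computable_real b k X ->
  (forall Phi al ns, length ns = k -> X Phi al ns = Y Phi al ns) ->
  computable_real b k Y.
Proof.
intros H E; eapply arithmetical_ext; [exact H|].
intros Phi al [|n ns] Hn; [discriminate|]; simpl; rewrite E by auto; reflexivity.
Qed.

Lemma computable_real_weak b k X :
  computable_real b k X -> computable_real b (S k) (fun Phi al ns => X Phi al (tl ns)).
Proof. exact (computable_weak1 _ _ _). Qed.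

Lemma computable_real_weak1 b k X :
  computable_real b (S k) X ->
  computable_real b (S (S k)) (fun Phi al ns => X Phi al (hd 0%nat ns :: tl (tl ns))).
Proof.
intros H; apply (computable_weak_at 2) in H; eapply computable_ext; [exact H|].
intros Phi al [|a [|c [|d ns]]]; simpl; try discriminate; reflexivity.
Qed.

Lemma arithmetical_cut b k X A :
  computable_real b k X -> computable b k A ->
  arithmetical b k (fun Phi al ns => q2 (A Phi al ns) < X Phi al ns).
Proof.
intros HX HA; exact (computable_push _ _ _ _ HX HA).
Qed.

Lemma arithmetical_Rlt b k X Y :
  computable_real b k X -> computable_real b k Y ->
  arithmetical b k (fun Phi al ns => X Phi al ns < Y Phi al ns).
Proof.
intros HX HY; eapply arithmetical_ext;
  [apply (arithmetical_exists b k
     (fun Phi al ns a => ~ q2 a < X Phi al ns /\ q2 a < Y Phi al ns));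
   exact (arithmetical_and _ _ _ _ (arithmetical_not _ _ _ HX) HY)|].
intros Phi al ns _; simpl; split.
- intros (a & H1 & H2); lra.
- intros H; destruct (q2_dense _ _ H) as (a & H1 & H2); exists a; split; lra.
Qed.

Lemma arithmetical_Rle b k X Y :
  computable_real b k X -> computable_real b k Y ->
  arithmetical b k (fun Phi al ns => X Phi al ns <= Y Phi al ns).
Proof.
intros HX HY; eapply arithmetical_ext;
  [exact (arithmetical_not _ _ _ (arithmetical_Rlt _ _ _ _ HY HX))|].
intros; simpl; lra.
Qed.

Lemma computable_fraction b k A B D :
  computable b k A -> computable b k B -> computable b k D ->
  computable b k (fun Phi al ns => fraction (A Phi al ns) (B Phi al ns) (D Phi al ns)).
Proof.
intros HA HB HD; exact (computable_npair _ _ _ _ (computable_npair _ _ _ _ HA HB) HD).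
Qed.

Lemma computable_numer_pos b k A :
  computable b k A -> computable b k (fun Phi al ns => numer_pos (A Phi al ns)).
Proof. intros HA; exact (computable_code_fst _ _ _ (computable_code_fst _ _ _ HA)). Qed.

Lemma computable_numer_neg b k A :
  computable b k A -> computable b k (fun Phi al ns => numer_neg (A Phi al ns)).
Proof. intros HA; exact (computable_code_snd _ _ _ (computable_code_fst _ _ _ HA)). Qed.

Lemma computable_denom b k A :
  computable b k A -> computable b k (fun Phi al ns => denom (A Phi al ns)).
Proof. intros HA; exact (computable_succ _ _ _ (computable_code_snd _ _ _ HA)). Qed.

Ltac fraction_computability :=
  repeat first
    [ assumption | apply computable_const | apply computable_fraction
    | apply computable_numer_pos | apply computable_numer_neg | apply computable_denom
    | apply computable_code_snd | apply computable_pred | apply computable_add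
    | apply computable_mul | apply computable_pow2 | apply computable_succ ].

Lemma computable_radd b k A B :
  computable b k A -> computable b k B ->
  computable b k (fun Phi al ns => radd (A Phi al ns) (B Phi al ns)).
Proof. intros; unfold radd; fraction_computability. Qed.

Lemma computable_ropp b k A :
  computable b k A -> computable b k (fun Phi al ns => ropp (A Phi al ns)).
Proof. intros; unfold ropp; fraction_computability. Qed.

Lemma computable_dyadic b k A B :
  computable b k A -> computable b k B ->
  computable b k (fun Phi al ns => dyadic (A Phi al ns) (B Phi al ns)).
Proof. intros; unfold dyadic; fraction_computability. Qed.

Lemma arithmetical_q2_lt b k A B :
  computable b k A -> computable b k B ->
  arithmetical b k (fun Phi al ns => q2 (A Phi al ns) < q2 (B Phi al ns)).
Proof.
intros HA HB; eapply arithmetical_ext; [|intros; symmetry; apply q2_lt].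
apply arithmetical_le; fraction_computability.
Qed.

Lemma computable_real_q2 b k A :
  computable b k A -> computable_real b k (fun Phi al ns => q2 (A Phi al ns)).
Proof.
intros HA; exact (arithmetical_q2_lt _ _ _ _ (computable_var0 _ _) (computable_weak _ _ _ HA)).
Qed.

Lemma computable_real_inv_pow2 b k A :
  computable b k A -> computable_real b k (fun Phi al ns => / 2 ^ A Phi al ns).
Proof.
intros HA; eapply computable_real_ext;
  [apply computable_real_q2, computable_dyadic; [apply (computable_const _ _ 1)|exact HA]|].
intros; cbv beta; rewrite q2_dyadic; simpl; ring.
Qed.

Lemma computable_real_0 b k : computable_real b k (fun _ _ _ => 0).
Proof.
eapply computable_real_ext; [apply computable_real_q2, (computable_const _ _ (dyadic 0 0))|].
intros; cbv beta; rewrite q2_dyadic; simpl; field.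
Qed.

Lemma computable_real_1 b k : computable_real b k (fun _ _ _ => 1).
Proof.
eapply computable_real_ext; [apply computable_real_q2, (computable_const _ _ (dyadic 1 0))|].
intros; cbv beta; rewrite q2_dyadic; simpl; field.
Qed.

Lemma computable_real_plus b k X Y :
  computable_real b k X -> computable_real b k Y ->
  computable_real b k (fun Phi al ns => X Phi al ns + Y Phi al ns).
Proof.
intros HX HY; eapply arithmetical_ext.
- apply (arithmetical_exists b (S k) (fun Phi al ns u => q2 u < X Phi al (tl ns) /\
    exists v, q2 v < Y Phi al (tl ns) /\ q2 (hd 0%nat ns) < q2 (radd u v))).
  apply arithmetical_and; [exact (computable_real_weak _ _ _ HX)|].
  apply (arithmetical_exists b (S (S k)) (fun Phi al ns v =>
    q2 v < Y Phi al (tl (tl ns)) /\ q2 (hd 0%nat (tl ns)) < q2 (radd (hd 0%nat ns) v))).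
  apply arithmetical_and.
  + exact (computable_real_weak _ _ _ (computable_real_weak _ _ _ HY)).
  + apply arithmetical_q2_lt; [exact (computable_var2 _ _)|].
    exact (computable_radd _ _ _ _ (computable_var1 _ _) (computable_var0 _ _)).
- intros Phi al [|a ns] Hn; [discriminate|]; simpl.
  set (x := X Phi al ns); set (y := Y Phi al ns); split.
  + intros (u & Hu & v & Hv & H); rewrite q2_radd in H; lra.
  + intros H.
    destruct (q2_dense (q2 a - y) x) as (u & Hu); [lra|].
    destruct (q2_dense (q2 a - q2 u) y) as (v & Hv); [lra|].
    exists u; split; [lra|]; exists v; rewrite q2_radd; split; lra.
Qed.

Lemma computable_real_opp b k X :
  computable_real b k X -> computable_real b k (fun Phi al ns => - X Phi al ns).
Proof.
intros HX; eapply arithmetical_ext.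
- apply (arithmetical_exists b (S k) (fun Phi al ns u =>
    ~ q2 u < X Phi al (tl ns) /\ q2 (hd 0%nat ns) < q2 (ropp u))).
  apply arithmetical_and; [exact (arithmetical_not _ _ _ (computable_real_weak _ _ _ HX))|].
  apply arithmetical_q2_lt; [exact (computable_var1 _ _)|].
  exact (computable_ropp _ _ _ (computable_var0 _ _)).
- intros Phi al [|a ns] Hn; [discriminate|]; simpl.
  set (x := X Phi al ns); split.
  + intros (u & Hu & H); rewrite q2_ropp in H; lra.
  + intros H; destruct (q2_dense x (- q2 a)) as (u & Hu); [lra|].
    exists u; rewrite q2_ropp; split; lra.
Qed.

Lemma computable_real_minus b k X Y :
  computable_real b k X -> computable_real b k Y ->
  computable_real b k (fun Phi al ns => X Phi al ns - Y Phi al ns).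
Proof.
intros HX HY; exact (computable_real_plus _ _ _ _ HX (computable_real_opp _ _ _ HY)).
Qed.

Lemma computable_real_Rabs b k X :
  computable_real b k X -> computable_real b k (fun Phi al ns => Rabs (X Phi al ns)).
Proof.
intros HX; eapply arithmetical_ext;
  [exact (arithmetical_or _ _ _ _ HX (computable_real_opp _ _ _ HX))|].
intros Phi al ns _; simpl; unfold Rabs; destruct Rcase_abs; lra.
Qed.

(** [sup_family P X] is the supremum of the [X n] with [P n], and 0 when there
    is no real supremum; that convention keeps the left cut decidable. *)
Definition sup_family (P : nat -> Prop) (X : nat -> R) : R :=
  real (Lub_Rbar (fun y => exists n, P n /\ y = X n)).

Lemma sup_family_lub (P : nat -> Prop) (X : nat -> R) :
  (exists n, P n) -> (exists M, forall n, P n -> X n <= M) ->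
  (forall n, P n -> X n <= sup_family P X) /\
  (forall M, (forall n, P n -> X n <= M) -> sup_family P X <= M).
Proof.
intros [n Hn] [M HM]; unfold sup_family.
destruct (Lub_Rbar_correct (fun y => exists n, P n /\ y = X n)) as [H1 H2].
assert (Hle := H1 _ (ex_intro _ n (conj Hn eq_refl))).
assert (Hub : Rbar_le (Lub_Rbar (fun y => exists n, P n /\ y = X n)) M).
{ apply H2; intros y (m & Hm & ->); exact (HM m Hm). }
destruct (Lub_Rbar _) as [l| |]; try contradiction; simpl; split.
- intros m Hm; exact (H1 _ (ex_intro _ m (conj Hm eq_refl))).
- intros M' HM'; apply (H2 (Finite M')); intros y (m & Hm & ->); exact (HM' m Hm).
Qed.

Lemma sup_family_undefined (P : nat -> Prop) (X : nat -> R) :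
  ~ ((exists n, P n) /\ exists M, forall n, P n -> X n <= M) -> sup_family P X = 0.
Proof.
intros N; unfold sup_family.
destruct (Lub_Rbar_correct (fun y => exists n, P n /\ y = X n)) as [H1 H2].
destruct (Lub_Rbar _) as [l| |]; try reflexivity.
destruct N; split.
- destruct (excluded_middle_informative (exists n, P n)) as [|N]; [assumption|].
  exfalso; apply (H2 m_infty); intros y (n & Hn & _); case N; exists n; exact Hn.
- exists l; intros n Hn; exact (H1 _ (ex_intro _ n (conj Hn eq_refl))).
Qed.

(** Both the existence of a real supremum and, given it, the cut are expressed
    by number quantifiers over the cuts of the members. *)
Lemma sup_family_cut (P : nat -> Prop) (X : nat -> R) a :
  let defined := (exists n, P n) /\ exists M, forall n, P n -> ~ q2 M < X n in
  (defined /\ exists n, P n /\ a < X n) \/ (~ defined /\ a < 0) <-> a < sup_family P X.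
Proof.
intros D.
assert (HD : D <-> (exists n, P n) /\ exists M, forall n, P n -> X n <= M).
{ split; intros [H1 [M H2]]; (split; [exact H1|]).
  - exists (q2 M); intros n Hn; specialize (H2 n Hn); lra.
  - destruct (q2_dense M (M + 1)) as [c Hc]; [lra|].
    exists c; intros n Hn; specialize (H2 n Hn); lra. }
destruct (excluded_middle_informative D) as [d|N].
- destruct (sup_family_lub P X (proj1 d) (proj2 (proj1 HD d))) as [H1 H2].
  split.
  + intros [[_ (n & Hn & H)]|[N _]]; [specialize (H1 n Hn); lra|contradiction].
  + intros H; left; split; [exact d|].
    destruct (excluded_middle_informative (exists n, P n /\ a < X n)) as [|N];
      [assumption|].
    enough (sup_family P X <= a) by lra; apply H2; intros n Hn.
    apply Rnot_lt_le; intros H'; apply N; exists n; split; assumption.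
- rewrite sup_family_undefined by (rewrite <- HD; exact N); tauto.
Qed.

Lemma computable_real_sup b k P X :
  arithmetical b (S k) (fun Phi al ns => P Phi al (tl ns) (hd 0%nat ns)) ->
  computable_real b (S k) (fun Phi al ns => X Phi al (tl ns) (hd 0%nat ns)) ->
  computable_real b k (fun Phi al ns =>
    sup_family (fun n => P Phi al ns n) (fun n => X Phi al ns n)).
Proof.
intros HP HX.
assert (HX' : arithmetical b (S (S k)) (fun Phi al ns =>
  q2 (hd 0%nat (tl ns)) < X Phi al (tl (tl ns)) (hd 0%nat ns))).
{ exact (arithmetical_cut _ _ _ _ (computable_real_weak1 _ _ _ HX) (computable_var1 _ _)). }
assert (HP' := computable_weak1 _ _ _ HP).
assert (HD : arithmetical b k (fun Phi al ns => (exists n, P Phi al ns n) /\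
  exists M, forall n, P Phi al ns n -> ~ q2 M < X Phi al ns n)).
{ apply arithmetical_and; [exact (arithmetical_exists _ _ _ HP)|].
  apply (arithmetical_exists b k (fun Phi al ns M =>
    forall n, P Phi al ns n -> ~ q2 M < X Phi al ns n)).
  apply (arithmetical_forall b (S k) (fun Phi al ns n =>
    P Phi al (tl ns) n -> ~ q2 (hd 0%nat ns) < X Phi al (tl ns) n)).
  exact (arithmetical_imp _ _ _ _ HP' (arithmetical_not _ _ _ HX')). }
apply computable_weak in HD.
eapply arithmetical_ext; [|intros Phi al ns _; apply sup_family_cut].
apply arithmetical_or; apply arithmetical_and.
- exact HD.
- apply (arithmetical_exists b (S k) (fun Phi al ns n =>
    P Phi al (tl ns) n /\ q2 (hd 0%nat ns) < X Phi al (tl ns) n)).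
  exact (arithmetical_and _ _ _ _ HP' HX').
- exact (arithmetical_not _ _ _ HD).
- exact (computable_real_0 b k).
Qed.

(** * Names of reals *)

Lemma represents_le al x n : represents al x -> Rabs (q2 (al n) - x) <= / 2 ^ n.
Proof.
intros [H1 H2].
assert (L : is_lim_seq (fun i => Rabs (q2 (al n) - q2 (al (i + n)%nat)))
  (Rabs (q2 (al n) - x))).
{ apply (is_lim_seq_abs _ (q2 (al n) - x)), is_lim_seq_minus';
    [apply is_lim_seq_const|].
  exact (proj1 (is_lim_seq_incr_n (fun i => q2 (al i)) n x) H2). }
apply (is_lim_seq_le _ _ (Rabs (q2 (al n) - x)) (/ 2 ^ n)) with (2 := L)
  (3 := is_lim_seq_const (/ 2 ^ n)).
intros i; rewrite Nat.add_comm; left; apply H1.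
Qed.

Lemma pow2_archimedes eps : 0 < eps -> exists n, / 2 ^ n < eps.
Proof.
intros He; destruct (pow_lt_1_zero (/ 2)) with (y := eps) as [N HN]; [|assumption|].
- rewrite Rabs_pos_eq; lra.
- exists N; specialize (HN N (Nat.le_refl N)); rewrite pow_inv in HN.
  rewrite Rabs_pos_eq in HN; [exact HN|left; apply inv_pow2_pos].
Qed.

Lemma inv_pow2_le m n : (m <= n)%nat -> / 2 ^ n <= / 2 ^ m.
Proof. intros H; apply Rinv_le_contravar; [apply pow2_pos|apply Rle_pow; [lra|exact H]]. Qed.

(** The represented real when [al] is a representation.  An index has to be
    defined on every operator and sequence, so the cut of [real_of al] must be
    decidable for every [al]; that is why it is a supremum of rationals. *)
Definition real_of (al : nat -> nat) : R :=
  sup_family (fun c => exists n, q2 c + / 2 ^ n < q2 (al n)) q2.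

Lemma real_of_represents al x : represents al x -> real_of al = x.
Proof.
intros H.
assert (Hlt : forall c, (exists n, q2 c + / 2 ^ n < q2 (al n)) -> q2 c <= x).
{ intros c [n Hn]; assert (L := represents_le al x n H).
  apply Rabs_le_between in L; lra. }
assert (Hex : forall c, q2 c < x -> exists n, q2 c + / 2 ^ n < q2 (al n)).
{ intros c Hc; destruct (pow2_archimedes ((x - q2 c) / 2)) as [n Hn]; [lra|].
  exists n; assert (L := represents_le al x n H).
  apply Rabs_le_between in L; lra. }
destruct (sup_family_lub (fun c => exists n, q2 c + / 2 ^ n < q2 (al n)) q2)
  as [H1 H2].
- destruct (q2_dense (x - 1) x) as [c Hc]; [lra|]; exists c; apply Hex; lra.
- exists x; exact Hlt.
- fold (real_of al) in H1, H2; apply Rle_antisym; [apply H2, Hlt|].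
  apply Rnot_lt_le; intros N; destruct (q2_dense _ _ N) as [c Hc].
  specialize (H1 c (Hex c (proj2 Hc))); lra.
Qed.

Lemma computable_real_of b k A :
  computable b (S k) (fun Phi al ns => A Phi al (tl ns) (hd 0%nat ns)) ->
  computable_real b k (fun Phi al ns => real_of (fun n => A Phi al ns n)).
Proof.
intros HA.
apply (computable_real_sup b k
  (fun Phi al ns c => exists n, q2 c + / 2 ^ n < q2 (A Phi al ns n)) (fun _ _ _ c => q2 c));
  [|apply computable_real_q2, computable_var0].
apply (arithmetical_exists b (S k) (fun Phi al ns n =>
  q2 (hd 0%nat ns) + / 2 ^ n < q2 (A Phi al (tl ns) n))).
apply arithmetical_Rlt; [apply computable_real_plus|].
- exact (computable_real_q2 _ _ _ (computable_var1 _ _)).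
- exact (computable_real_inv_pow2 _ _ _ (computable_var0 _ _)).
- exact (computable_real_q2 _ _ _ (computable_weak1 _ _ _ HA)).
Qed.

Lemma arithmetical_True b k : arithmetical b k (fun _ _ _ => True).
Proof.
eapply computable_ext; [exact (computable_const b k 0)|].
intros; symmetry; apply ind_true, I.
Qed.

(** Choosing the least admissible code at each stage makes the name a function of
    the real alone. *)
Definition name_of (x : R) (n : nat) : nat :=
  mu (fun c => q2 c < x /\ x <= q2 c + / 2 ^ S n).

Lemma name_of_spec x n : q2 (name_of x n) < x <= q2 (name_of x n) + / 2 ^ S n.
Proof.
apply (mu_spec (fun c => q2 c < x /\ x <= q2 c + / 2 ^ S n)).
destruct (q2_dense (x - / 2 ^ S n) x) as [c Hc].
- pose proof (inv_pow2_pos (S n)); lra.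
- exists c; lra.
Qed.

Lemma represents_name_of x : represents (name_of x) x.
Proof.
split.
- intros n i; fold (q2 (name_of x n)); fold (q2 (name_of x (n + i))).
  pose proof (name_of_spec x n); pose proof (name_of_spec x (n + i)).
  pose proof (inv_pow2_pos n).
  assert (/ 2 ^ S (n + i) <= / 2 ^ S n) by (apply inv_pow2_le; lia).
  rewrite (inv_pow2_S n) in *; apply Rabs_def1; lra.
- apply is_lim_seq_Reals; intros eps He.
  destruct (pow2_archimedes eps He) as [N HN]; exists N; intros n Hn.
  fold (q2 (name_of x n)); pose proof (name_of_spec x n).
  assert (/ 2 ^ S n <= / 2 ^ N) by (apply inv_pow2_le; lia).
  unfold R_dist, Rdist; apply Rabs_def1; lra.
Qed.

Lemma computable_name_of b k X N :
  computable_real b k X -> computable b k N ->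
  computable b k (fun Phi al ns => name_of (X Phi al ns) (N Phi al ns)).
Proof.
intros HX HN.
apply (computable_mu b k (fun Phi al ns c =>
  q2 c < X Phi al ns /\ X Phi al ns <= q2 c + / 2 ^ S (N Phi al ns))).
apply arithmetical_and; [exact HX|].
apply arithmetical_Rle; [exact (computable_real_weak _ _ _ HX)|].
apply computable_real_plus; [exact (computable_real_q2 _ _ _ (computable_var0 _ _))|].
exact (computable_real_inv_pow2 _ _ _ (computable_succ _ _ _ (computable_weak _ _ _ HN))).
Qed.

Ltac computable_variable :=
  first [ apply computable_var0 | apply computable_var1 | apply computable_var2
        | apply computable_var3 ].

Ltac computability_step :=
  lazymatch goal with
  | |- computable _ _ (fun _ _ _ => ?c) => apply computable_const
  | |- computable _ _ (fun Phi al ns => hd 0%nat (@?t ns)) => computable_variable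
  | |- computable _ _ (fun Phi al ns => S (@?t Phi al ns)) => apply computable_succ
  | |- computable _ _ (fun Phi al ns => code_fst (@?t Phi al ns)) =>
      apply computable_code_fst
  | |- computable _ _ (fun Phi al ns => code_snd (@?t Phi al ns)) =>
      apply computable_code_snd
  | |- computable _ _ (fun Phi al ns => dyadic (@?t Phi al ns) (@?u Phi al ns)) =>
      apply computable_dyadic
  | |- computable _ _ (fun Phi al ns => Nat.pow 2 (@?u Phi al ns)) =>
      apply computable_pow2
  | |- computable _ _ (fun Phi al ns => mu (@?P Phi al ns)) => apply computable_mu
  | |- computable _ _ (fun Phi al ns => name_of (@?x Phi al ns) (@?t Phi al ns)) =>
      apply computable_name_of
  | |- computable _ _ (fun Phi al ns => Phi (@?t Phi al ns) (@?u Phi al ns)) =>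
      apply computable_operator
  | |- computable true _ (fun Phi al ns => al (@?t Phi al ns)) =>
      apply computable_oracle
  | |- computable _ _ (fun Phi al ns =>
      if excluded_middle_informative (@?P Phi al ns)
      then @?t Phi al ns else @?u Phi al ns) => apply computable_ite
  | |- computable _ _ (fun Phi al ns =>
      match @?t Phi al ns with O => @?u Phi al ns | S x => @?v Phi al ns x end) =>
      apply computable_case
  | |- computable _ _ (fun Phi al ns =>
      nat_rect _ (@?t Phi al ns) (@?u Phi al ns) (@?v Phi al ns)) =>
      apply computable_rect
  | |- arithmetical _ _ (fun _ _ _ => True) => apply arithmetical_True
  | |- arithmetical _ _ (fun Phi al ns => (@?P Phi al ns) /\ (@?Q Phi al ns)) =>
      apply arithmetical_and
  | |- arithmetical _ _ (fun Phi al ns => ~ (@?P Phi al ns)) =>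
      apply arithmetical_not
  | |- arithmetical _ _ (fun Phi al ns => exists n : nat, @?P Phi al ns n) =>
      apply arithmetical_exists
  | |- arithmetical _ _ (fun Phi al ns => (@?x Phi al ns) < (@?y Phi al ns)) =>
      apply arithmetical_Rlt
  | |- arithmetical _ _ (fun Phi al ns => (@?x Phi al ns) <= (@?y Phi al ns)) =>
      apply arithmetical_Rle
  | |- arithmetical _ _ (fun Phi al ns => ((@?x Phi al ns) <= (@?y Phi al ns))%nat) =>
      apply arithmetical_le
  | |- arithmetical _ _ (fun Phi al ns => (@?P Phi al ns) -> (@?Q Phi al ns)) =>
      apply arithmetical_imp
  | |- arithmetical _ _ (fun Phi al ns => forall n : nat, @?P Phi al ns n) =>
      apply arithmetical_forall
  | |- computable_real _ _ (fun _ _ _ => 0) => apply computable_real_0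
  | |- computable_real _ _ (fun _ _ _ => 1) => apply computable_real_1
  | |- computable_real _ _ (fun Phi al ns => (@?x Phi al ns) + (@?y Phi al ns)) =>
      apply computable_real_plus
  | |- computable_real _ _ (fun Phi al ns => (@?x Phi al ns) - (@?y Phi al ns)) =>
      apply computable_real_minus
  | |- computable_real _ _ (fun Phi al ns => Rabs (@?x Phi al ns)) =>
      apply computable_real_Rabs
  | |- computable_real _ _ (fun Phi al ns => / 2 ^ (@?t Phi al ns)) =>
      apply computable_real_inv_pow2
  | |- computable_real _ _ (fun Phi al ns => q2 (@?t Phi al ns)) =>
      apply computable_real_q2
  | |- computable_real _ _ (fun Phi al ns => sup_family (@?P Phi al ns) (@?x Phi al ns)) =>
      apply computable_real_sup
  | |- computable_real _ _ (fun Phi al ns => real_of (@?t Phi al ns)) =>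
      apply computable_real_of
  end; cbv beta.

Ltac computability := cbv beta; repeat computability_step.

(** * Quasi-continuous functions and their rational values *)

(** The open set provided by quasi-continuity is relative to [[0,1]], so a small
    interval around one of its points still has to be cut down to [[0,1]]. *)
Lemma quasi_continuous_interval f x a b eps :
  quasi_continuous f -> I01 x -> a < x < b -> 0 < eps ->
  exists c d, c < d /\
    forall y, c < y < d -> I01 y /\ a < y < b /\ Rabs (f x - f y) < eps.
Proof.
intros Hf Hx Hab He.
destruct (Hf x eps (fun y => a < y < b /\ I01 y)) as (G & HG & [y Hy] & HGU & HGe);
  auto.
{ exists (fun y => a < y < b); split; [|tauto].
  apply open_and; [apply open_gt|apply open_lt]. }
destruct HG as (V & HV & HGV).
destruct (proj1 (HGV y) Hy) as [HVy [Hy0 Hy1]].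
destruct (HV y HVy) as [r Hr].
assert (Hr0 := cond_pos r).
exists (Rmax 0 (y - r)), (Rmin 1 (y + r)); split.
- unfold Rmax, Rmin; repeat destruct Rle_dec; lra.
- intros z [Hz1 Hz2].
  assert (0 < z /\ y - r < z) as [Hz3 Hz4].
  { split; apply (Rle_lt_trans _ (Rmax 0 (y - r))); try assumption;
      [apply Rmax_l|apply Rmax_r]. }
  assert (z < 1 /\ z < y + r) as [Hz5 Hz6].
  { split; apply (Rlt_le_trans _ (Rmin 1 (y + r))); try assumption;
      [apply Rmin_l|apply Rmin_r]. }
  assert (Gz : G z).
  { apply HGV; split; [|unfold I01; lra].
    apply Hr; apply Rabs_def1; unfold minus, plus, opp; simpl; lra. }
  destruct (HGU z Gz); auto.
Qed.

Lemma quasi_continuous_rational f x a b eps :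
  quasi_continuous f -> I01 x -> a < x < b -> 0 < eps ->
  exists c, I01 (q2 c) /\ a < q2 c < b /\ Rabs (f x - f (q2 c)) < eps.
Proof.
intros Hf Hx Hab He.
destruct (quasi_continuous_interval f x a b eps Hf Hx Hab He) as (c & d & Hcd & H).
destruct (q2_dense c d Hcd) as [r Hr]; exists r; exact (H (q2 r) Hr).
Qed.

Lemma represents_const c : represents (fun _ => c) (q2 c).
Proof.
split.
- intros n i; rewrite Rminus_diag, Rabs_R0; apply inv_pow2_pos.
- apply is_lim_seq_const.
Qed.

Definition value (Phi : operator) (c : nat) : R := real_of (Phi (fun _ => c)).

Lemma value_correct Phi f c : fun_represents Phi f -> I01 (q2 c) -> value Phi c = f (q2 c).
Proof. intros H Hc; apply real_of_represents, H; [exact Hc|apply represents_const]. Qed.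

Definition window (a b : R) (c : nat) : Prop := I01 (q2 c) /\ a < q2 c /\ q2 c < b.

Definition osc_le (Phi : operator) (a b e : R) : Prop :=
  forall c d, window a b c -> window a b d -> value Phi c - value Phi d <= e.

Ltac arithmetic_definitions := unfold osc_le, window, value, I01.

(** The values at [y] and [z] are approximated by values at rationals of the same
    interval, so a bound on the differences at rationals is a bound on all. *)
Lemma osc_le_iff Phi f a b e :
  fun_represents Phi f -> quasi_continuous f ->
  osc_le Phi a b e <->
  forall y z, I01 y -> I01 z -> a < y < b -> a < z < b -> f y - f z <= e.
Proof.
intros HP Hf; split.
- intros H y z Hy Hz Hy' Hz'; apply le_epsilon; intros eps He.
  destruct (quasi_continuous_rational f y a b (eps / 2)) as (c & Hc1 & Hc2 & Hc3); auto; [lra|].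
  destruct (quasi_continuous_rational f z a b (eps / 2)) as (d & Hd1 & Hd2 & Hd3); auto; [lra|].
  specialize (H c d (conj Hc1 Hc2) (conj Hd1 Hd2)).
  rewrite !(value_correct Phi f) in H by assumption.
  apply Rabs_def2 in Hc3; apply Rabs_def2 in Hd3; lra.
- intros H c d [Hc1 Hc2] [Hd1 Hd2].
  rewrite !(value_correct Phi f) by assumption; apply H; assumption.
Qed.

Lemma osc_le_subinterval Phi a b a' b' e :
  a <= a' -> b' <= b -> osc_le Phi a b e -> osc_le Phi a' b' e.
Proof.
intros Ha Hb H c d (Hc & Hc') (Hd & Hd'); apply H; split; auto; lra.
Qed.

Lemma cont_set_eps f x : cont_set f x <->
  I01 x /\ forall eps, 0 < eps -> exists r, 0 < r /\
    forall y, I01 y -> Rabs (y - x) < r -> Rabs (f y - f x) < eps.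
Proof.
unfold cont_set; rewrite filterlim_locally; split; intros [Hx H]; (split; [exact Hx|]).
- intros eps He; destruct (H (mkposreal eps He)) as [r Hr].
  exists r; split; [apply cond_pos|]; intros y Hy Hyx; exact (Hr y Hyx Hy).
- intros eps; destruct (H eps (cond_pos eps)) as (r & Hr & Hy).
  exists (mkposreal r Hr); intros y Hyx Hy01; exact (Hy y Hy01 Hyx).
Qed.

Lemma cont_set_of_osc_le Phi f x :
  fun_represents Phi f -> quasi_continuous f -> I01 x ->
  (forall k, exists a b, a < x < b /\ osc_le Phi a b (/ 2 ^ k)) -> cont_set f x.
Proof.
intros HP Hf Hx H; apply cont_set_eps; split; [exact Hx|]; intros eps He.
destruct (pow2_archimedes eps He) as [k Hk].
destruct (H k) as (a & b & Hab & Ho).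
rewrite (osc_le_iff Phi f) in Ho by assumption.
exists (Rmin (x - a) (b - x)); split; [apply Rmin_pos; lra|]; intros y Hy Hyx.
assert (H1 := Rmin_l (x - a) (b - x)); assert (H2 := Rmin_r (x - a) (b - x)).
apply Rabs_def2 in Hyx.
assert (f y - f x <= / 2 ^ k) by (apply Ho; auto; lra).
assert (f x - f y <= / 2 ^ k) by (apply Ho; auto; lra).
apply Rabs_def1; lra.
Qed.

Lemma osc_le_of_cont_set Phi f x e :
  fun_represents Phi f -> quasi_continuous f -> cont_set f x -> 0 < e ->
  exists N, osc_le Phi (x - / 2 ^ N) (x + / 2 ^ N) e.
Proof.
intros HP Hf Hx He; apply cont_set_eps in Hx; destruct Hx as [Hx H].
destruct (H (e / 2)) as (r & Hr & Hy); [lra|].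
destruct (pow2_archimedes r Hr) as [N HN]; exists N.
apply (osc_le_iff Phi f); auto; intros y z Hy0 Hz0 Hy1 Hz1.
assert (H1 : Rabs (f y - f x) < e / 2) by (apply Hy; auto; apply Rabs_def1; lra).
assert (H2 : Rabs (f z - f x) < e / 2) by (apply Hy; auto; apply Rabs_def1; lra).
apply Rabs_def2 in H1; apply Rabs_def2 in H2; lra.
Qed.

Lemma cont_set_iff Phi f x :
  fun_represents Phi f -> quasi_continuous f ->
  cont_set f x <->
  I01 x /\ forall k, exists N, osc_le Phi (x - / 2 ^ N) (x + / 2 ^ N) (/ 2 ^ k).
Proof.
intros HP Hf; split.
- intros H; split; [apply H|]; intros k.
  exact (osc_le_of_cont_set Phi f x (/ 2 ^ k) HP Hf H (inv_pow2_pos k)).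
- intros [Hx H]; apply (cont_set_of_osc_le Phi); auto; intros k.
  destruct (H k) as [N HN]; exists (x - / 2 ^ N), (x + / 2 ^ N); split; [|exact HN].
  assert (H0 := inv_pow2_pos N); lra.
Qed.

(** * From computability to indices *)

Lemma index_with_oracle k F :
  computable true k F -> exists e, forall Phi al ns, length ns = k ->
    computes e Phi (fn al :: map num ns) (F Phi al ns).
Proof. exact (computable_top true k F). Qed.

Lemma index_without_oracle k F :
  computable false k F -> exists e, forall Phi ns, length ns = k ->
    computes e Phi (map num ns) (F Phi (fun _ => O) ns).
Proof.
intros H; destruct (computable_top false k F H) as [e He]; exists e; intros Phi ns Hn.
exact (He Phi (fun _ => O) ns Hn).
Qed.

(** * Points of continuity *)

Definition small_oscillations (Phi : operator) (x : R) : Prop :=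
  I01 x /\ forall k, exists N, osc_le Phi (x - / 2 ^ N) (x + / 2 ^ N) (/ 2 ^ k).

Lemma cont_set_computable :
  exists e : nat,
    forall Phi f, fun_represents Phi f -> quasi_continuous f ->
    exists X : (nat -> nat) -> nat,
      (forall alpha, computes e Phi [fn alpha] (X alpha)) /\
      is_char X (cont_set f).
Proof.
destruct (index_with_oracle 0 (fun Phi al _ =>
  if excluded_middle_informative (small_oscillations Phi (real_of al)) then 1%nat else 0%nat))
  as [e He].
{ unfold small_oscillations; arithmetic_definitions; computability. }
exists e; intros Phi f HP Hf; eexists; split.
- intros alpha; exact (He Phi alpha [] eq_refl).
- intros alpha x Hx; cbv beta; rewrite (real_of_represents alpha x Hx).
  rewrite (cont_set_iff Phi f x HP Hf); fold (small_oscillations Phi x).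
  destruct excluded_middle_informative; tauto.
Qed.

Definition next_interval (Phi : operator) (I n : nat) : nat :=
  mu (fun m =>
    q2 (code_fst I) < q2 (code_fst m) /\ q2 (code_fst m) < q2 (code_snd m) /\
    q2 (code_snd m) < q2 (code_snd I) /\
    osc_le Phi (q2 (code_fst m)) (q2 (code_snd m)) (/ 2 ^ n)).

Definition nested (Phi : operator) (n : nat) : nat :=
  nat_rect (fun _ => nat) (npair (dyadic 0 0) (dyadic 1 0))
    (fun n I => next_interval Phi I n) n.

Definition continuity_point (Phi : operator) : R :=
  sup_family (fun _ => True) (fun n => q2 (code_fst (nested Phi n))).

(** Quasi-continuity at the midpoint of [I] provides a subinterval on which [f] is
    within [2^-n / 2] of one value. *)
Lemma next_interval_spec Phi f I n :
  fun_represents Phi f -> quasi_continuous f ->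
  0 <= q2 (code_fst I) -> q2 (code_fst I) < q2 (code_snd I) -> q2 (code_snd I) <= 1 ->
  let m := next_interval Phi I n in
  q2 (code_fst I) < q2 (code_fst m) /\ q2 (code_fst m) < q2 (code_snd m) /\
  q2 (code_snd m) < q2 (code_snd I) /\
  osc_le Phi (q2 (code_fst m)) (q2 (code_snd m)) (/ 2 ^ n).
Proof.
intros HP Hf H0 H01 H1.
apply (mu_spec (fun m =>
  q2 (code_fst I) < q2 (code_fst m) /\ q2 (code_fst m) < q2 (code_snd m) /\
  q2 (code_snd m) < q2 (code_snd I) /\
  osc_le Phi (q2 (code_fst m)) (q2 (code_snd m)) (/ 2 ^ n))).
set (a := q2 (code_fst I)) in *; set (b := q2 (code_snd I)) in *.
pose (x := (a + b) / 2).
destruct (quasi_continuous_interval f x a b (/ 2 ^ n / 2)) as (c & d & Hcd & H);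
  unfold x, I01; auto; try lra.
{ pose proof (inv_pow2_pos n); lra. }
destruct (q2_dense c d Hcd) as [r Hr].
destruct (q2_dense c (q2 r)) as [l Hl]; [lra|].
destruct (H (q2 l)) as (_ & Hl' & _); [lra|].
destruct (H (q2 r)) as (_ & Hr' & _); [lra|].
exists (npair l r); rewrite code_fst_npair, code_snd_npair.
repeat split; try lra.
apply (osc_le_iff Phi f); auto; intros y z _ _ Hy Hz.
destruct (H y) as (_ & _ & Hy'); [lra|]; destruct (H z) as (_ & _ & Hz'); [lra|].
apply Rabs_def2 in Hy'; apply Rabs_def2 in Hz'; lra.
Qed.

(** Because the intervals are strictly nested, the supremum of their left end
    points lies in the interior of each of them. *)
Lemma continuity_point_spec Phi f :
  fun_represents Phi f -> quasi_continuous f ->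
  cont_set f (continuity_point Phi) /\ 0 < continuity_point Phi < 1.
Proof.
intros HP Hf.
pose (l n := q2 (code_fst (nested Phi n))); pose (r n := q2 (code_snd (nested Phi n))).
assert (Hin : forall n, 0 <= l n /\ l n < r n /\ r n <= 1).
{ unfold l, r; induction n as [|n IH].
  - unfold nested; simpl nat_rect; rewrite code_fst_npair, code_snd_npair, !q2_dyadic.
    simpl; lra.
  - destruct IH as (I1 & I2 & I3).
    destruct (next_interval_spec Phi f (nested Phi n) n HP Hf I1 I2 I3) as (J1 & J2 & J3 & _).
    change (nested Phi (S n)) with (next_interval Phi (nested Phi n) n); lra. }
assert (Hstep : forall n, l n < l (S n) /\ r (S n) < r n /\
  osc_le Phi (l (S n)) (r (S n)) (/ 2 ^ n)).
{ intros n; destruct (Hin n) as (I1 & I2 & I3).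
  destruct (next_interval_spec Phi f (nested Phi n) n HP Hf I1 I2 I3) as (J1 & J2 & J3 & J4).
  auto. }
assert (Hl : forall n i, l n <= l (i + n)%nat).
{ induction i as [|i IH]; [simpl; lra|]; destruct (Hstep (i + n)%nat); simpl; lra. }
assert (Hr : forall n i, r (i + n)%nat <= r n).
{ induction i as [|i IH]; [simpl; lra|]; destruct (Hstep (i + n)%nat); simpl; lra. }
assert (Hlr : forall m n, l m <= r n).
{ intros m n; specialize (Hl m n); specialize (Hr n m).
  rewrite Nat.add_comm in Hr; destruct (Hin (n + m)%nat); lra. }
destruct (sup_family_lub (fun _ => True) l) as [H1 H2].
{ exists O; exact I. }
{ exists 1; intros n _; destruct (Hin n); lra. }
change (sup_family (fun _ => True) l) with (continuity_point Phi) in H1, H2.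
assert (Hx : forall n, l n < continuity_point Phi < r n).
{ intros n; destruct (Hstep n) as (J1 & J2 & _); split.
  - specialize (H1 (S n) I); lra.
  - specialize (H2 (r (S n)) (fun m _ => Hlr m (S n))); lra. }
assert (H01 : 0 < continuity_point Phi < 1).
{ specialize (Hx O); destruct (Hin O); lra. }
split; [|exact H01].
apply (cont_set_of_osc_le Phi); auto; [unfold I01; lra|].
intros k; exists (l (S k)), (r (S k)); split; [apply Hx|apply Hstep].
Qed.

Lemma continuity_point_computable :
  exists e : nat, forall Phi f, fun_represents Phi f -> quasi_continuous f ->
    exists (alpha : nat -> nat) (x : R),
      (forall n, computes e Phi [num n] (alpha n)) /\
      represents alpha x /\ cont_set f x /\ 0 < x < 1.
Proof.
destruct (index_without_oracle 1 (fun Phi _ ns => name_of (continuity_point Phi) (hd O ns)))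
  as [e He].
{ unfold continuity_point, nested, next_interval; arithmetic_definitions; computability. }
exists e; intros Phi f HP Hf; exists (name_of (continuity_point Phi)), (continuity_point Phi).
split; [intros n; exact (He Phi [n] eq_refl)|].
split; [apply represents_name_of|apply (continuity_point_spec Phi f HP Hf)].
Qed.

Lemma fst_rat_pair m : fst (rat_pair m) = rat (code_fst m).
Proof. unfold rat_pair, code_fst; destruct (Cantor.of_nat m); reflexivity. Qed.

Lemma snd_rat_pair m : snd (rat_pair m) = rat (code_snd m).
Proof. unfold rat_pair, code_snd; destruct (Cantor.of_nat m); reflexivity. Qed.

(** The centre lies in [[0,1]] and the radius is small, so that a point that is
    in such balls for all [n] belongs to [[0,1]]. *)
Definition small_osc_ball (Phi : operator) (n m : nat) : Prop :=
  I01 (q2 (code_fst m)) /\ q2 (code_snd m) < / 2 ^ n /\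
  osc_le Phi (q2 (code_fst m) - q2 (code_snd m)) (q2 (code_fst m) + q2 (code_snd m))
    (/ 2 ^ n).

Definition small_osc_open (Phi : operator) (n m : nat) : nat :=
  (* the code 0 stands for an empty ball *)
  if excluded_middle_informative (small_osc_ball Phi n m) then m else O.

Lemma small_osc_open_spec Phi n x :
  RM_open_set (small_osc_open Phi n) x <->
  exists m, small_osc_ball Phi n m /\ Rabs (x - q2 (code_fst m)) < q2 (code_snd m).
Proof.
unfold RM_open_set, small_osc_open; split; intros [m Hm].
- rewrite fst_rat_pair, snd_rat_pair in Hm.
  destruct excluded_middle_informative as [H|H]; [exists m; split; assumption|].
  exfalso; revert Hm; apply Rle_not_lt.
  assert (E : q2 (code_snd 0) = 0).
  { unfold q2; change (code_snd 0) with O; unfold rat, Q2R; simpl; ring. }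
  fold (q2 (code_snd 0)); rewrite E; apply Rabs_pos.
- exists m; rewrite fst_rat_pair, snd_rat_pair.
  destruct Hm as [H Hm]; destruct excluded_middle_informative; [exact Hm|contradiction].
Qed.

Lemma cont_set_RM_open :
  exists e : nat,
    forall Phi f, fun_represents Phi f -> quasi_continuous f ->
    exists O : nat -> nat -> nat,
      (forall n m, computes e Phi [num n; num m] (O n m)) /\
      forall x, cont_set f x <-> forall n, RM_open_set (O n) x.
Proof.
destruct (index_without_oracle 2 (fun Phi _ ns =>
  small_osc_open Phi (hd O ns) (hd O (tl ns)))) as [e He].
{ unfold small_osc_open, small_osc_ball; arithmetic_definitions; computability. }
exists e; intros Phi f HP Hf; exists (small_osc_open Phi).
split; [intros n m; exact (He Phi [n; m] eq_refl)|].
intros x; split.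
- intros Hx n; apply small_osc_open_spec.
  destruct (osc_le_of_cont_set Phi f x (/ 2 ^ n) HP Hf Hx (inv_pow2_pos n)) as [N HN].
  set (d := / 2 ^ N) in *; assert (Hd : 0 < d) by apply inv_pow2_pos.
  assert (Hn := inv_pow2_pos n).
  destruct (q2_dense 0 (Rmin (d / 2) (/ 2 ^ n))) as [r Hr]; [apply Rmin_pos; lra|].
  assert (H1 := Rmin_l (d / 2) (/ 2 ^ n)); assert (H2 := Rmin_r (d / 2) (/ 2 ^ n)).
  destruct (quasi_continuous_rational f x (x - q2 r) (x + q2 r) 1)
    as (c & Hc & Hcr & _); auto; try lra; [apply Hx|].
  exists (npair c r); unfold small_osc_ball; rewrite code_fst_npair, code_snd_npair.
  split; [split; [exact Hc|split; [lra|]]|apply Rabs_def1; lra].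
  apply (osc_le_subinterval Phi (x - d) (x + d)); auto; lra.
- intros H.
  assert (H' : forall n, exists m, small_osc_ball Phi n m /\
    Rabs (x - q2 (code_fst m)) < q2 (code_snd m)) by (intros n; apply small_osc_open_spec, H).
  assert (Hx : I01 x).
  { split; apply Rnot_lt_le; intros N.
    - destruct (pow2_archimedes (- x)) as [n Hn]; [lra|].
      destruct (H' n) as (m & ([Hm0 Hm1] & Hm2 & _) & Hm3); apply Rabs_def2 in Hm3; lra.
    - destruct (pow2_archimedes (x - 1)) as [n Hn]; [lra|].
      destruct (H' n) as (m & ([Hm0 Hm1] & Hm2 & _) & Hm3); apply Rabs_def2 in Hm3; lra. }
  apply (cont_set_of_osc_le Phi); auto; intros k.
  destruct (H' k) as (m & (_ & _ & Hm2) & Hm3); eexists; eexists; split; [|exact Hm2].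
  apply Rabs_def2 in Hm3; lra.
Qed.

(** * Suprema and oscillation *)

(** Differences of values avoid a case distinction on infinite suprema and
    infima. *)
Lemma Rbar_lt_osc_on f (D : R -> Prop) (a : R) : (exists x, D x) ->
  Rbar_lt a (osc_on f D) <-> exists y z, D y /\ D z /\ a < f y - f z.
Proof.
intros [x Dx]; unfold osc_on.
destruct (Lub_Rbar_correct (image f D)) as [L1 L2].
destruct (Glb_Rbar_correct (image f D)) as [G1 G2].
set (L := Lub_Rbar (image f D)) in *; set (G := Glb_Rbar (image f D)) in *.
assert (Hi : forall y, D y -> image f D (f y)) by (intros y Hy; exists y; auto).
split.
- intros H.
  (* [L - G > a] leaves room for a real [s] with [s < L] and [G < s - a] *)
  assert (Hs : exists s : R, Rbar_lt s L /\ Rbar_lt G (s - a)).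
  { assert (HL := L1 _ (Hi x Dx)); assert (HG := G1 _ (Hi x Dx)).
    destruct L as [l| |]; destruct G as [g| |]; simpl in *; try contradiction.
    - exists ((l + a + g) / 2); lra.
    - exists (l - 1); split; [lra|exact I].
    - exists (g + a + 1); split; [exact I|lra].
    - exists 0; auto. }
  destruct Hs as (s & HsL & HsG).
  assert (Hy : exists y, D y /\ s < f y).
  { destruct (excluded_middle_informative (exists y, D y /\ s < f y)) as [|N]; [assumption|].
    exfalso; apply (Rbar_lt_not_le _ _ HsL), L2; intros v (y & Hy & ->); simpl.
    apply Rnot_lt_le; intros Hlt; apply N; exists y; auto. }
  assert (Hz : exists z, D z /\ f z < s - a).
  { destruct (excluded_middle_informative (exists z, D z /\ f z < s - a)) as [|N];
      [assumption|].
    exfalso; apply (Rbar_lt_not_le _ _ HsG), G2; intros v (z & Hz & ->); simpl.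
    apply Rnot_lt_le; intros Hlt; apply N; exists z; auto. }
  destruct Hy as (y & Dy & Hy), Hz as (z & Dz & Hz); exists y, z; repeat split; auto; lra.
- intros (y & z & Dy & Dz & H).
  assert (HL := L1 _ (Hi y Dy)); assert (HG := G1 _ (Hi z Dz)).
  destruct L as [l| |]; destruct G as [g| |]; simpl in *; try contradiction; auto; lra.
Qed.

(** Up to an end point, the left cut of the oscillation at [x]. *)
Definition below_osc (Phi : operator) (x : R) (c : nat) : Prop :=
  forall k, exists c1 c2,
    window (x - / 2 ^ k) (x + / 2 ^ k) c1 /\ window (x - / 2 ^ k) (x + / 2 ^ k) c2 /\
    q2 c < value Phi c1 - value Phi c2.

Lemma below_osc_iff Phi f x c :
  fun_represents Phi f -> quasi_continuous f -> I01 x ->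
  below_osc Phi x c <->
  forall k, Rbar_lt (q2 c) (osc_on f (fun y => I01 y /\ Rabs (y - x) < / 2 ^ k)).
Proof.
intros HP Hf Hx.
assert (E : forall k, (exists c1 c2,
    window (x - / 2 ^ k) (x + / 2 ^ k) c1 /\ window (x - / 2 ^ k) (x + / 2 ^ k) c2 /\
    q2 c < value Phi c1 - value Phi c2) <->
    ~ osc_le Phi (x - / 2 ^ k) (x + / 2 ^ k) (q2 c)).
{ intros k; split.
  - intros (c1 & c2 & H1 & H2 & H) N; specialize (N c1 c2 H1 H2); lra.
  - intros N.
    destruct (excluded_middle_informative (exists c1 c2,
      window (x - / 2 ^ k) (x + / 2 ^ k) c1 /\ window (x - / 2 ^ k) (x + / 2 ^ k) c2 /\
      q2 c < value Phi c1 - value Phi c2)) as [|N']; [assumption|].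
    destruct N; intros c1 c2 H1 H2; apply Rnot_lt_le; intros H; apply N'.
    exists c1, c2; auto. }
unfold below_osc.
enough (E' : forall k, ~ osc_le Phi (x - / 2 ^ k) (x + / 2 ^ k) (q2 c) <->
  Rbar_lt (q2 c) (osc_on f (fun y => I01 y /\ Rabs (y - x) < / 2 ^ k))).
{ split; intros H k; apply E', E, H || apply E, E', H. }
intros k; rewrite (osc_le_iff Phi f _ _ _ HP Hf), Rbar_lt_osc_on;
  [|exists x; rewrite Rminus_diag, Rabs_R0; split; [exact Hx|apply inv_pow2_pos]].
split.
- intros N.
  destruct (excluded_middle_informative (exists y z,
    (I01 y /\ Rabs (y - x) < / 2 ^ k) /\ (I01 z /\ Rabs (z - x) < / 2 ^ k) /\
    q2 c < f y - f z)) as [|N']; [assumption|].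
  destruct N; intros y z Hy Hz Hy' Hz'; apply Rnot_lt_le; intros H; apply N'.
  exists y, z; repeat split; try apply Hy; try apply Hz; try exact H; apply Rabs_def1; lra.
- intros (y & z & [Hy Hy'] & [Hz Hz'] & H) N.
  apply Rabs_def2 in Hy'; apply Rabs_def2 in Hz'.
  specialize (N y z Hy Hz); lra.
Qed.

Lemma osc_on_mono f (D D' : R -> Prop) (a : R) : (exists x, D x) -> (forall x, D x -> D' x) ->
  Rbar_lt a (osc_on f D) -> Rbar_lt a (osc_on f D').
Proof.
intros [x Dx] HD H; apply Rbar_lt_osc_on in H; [|exists x; exact Dx].
destruct H as (y & z & Dy & Dz & H).
apply Rbar_lt_osc_on; [exists x; auto|]; exists y, z; auto.
Qed.

(** The oscillation is infinite exactly when every rational lies below it. *)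
Definition osc_name (Phi : operator) (x : R) (n : nat) : nat :=
  match n with
  | O => if excluded_middle_informative (exists c, ~ below_osc Phi x c)
         then 0%nat else 1%nat
  | S n => name_of (sup_family (fun c => below_osc Phi x c) (fun c => q2 c)) n
  end.

Lemma osc_name_spec Phi f x :
  fun_represents Phi f -> quasi_continuous f -> I01 x ->
  exists l : Rbar, is_osc_at f x l /\ represents_bar (osc_name Phi x) l.
Proof.
intros HP Hf Hx.
pose (D k y := I01 y /\ Rabs (y - x) < / 2 ^ k).
assert (Dx : forall k, exists y, D k y).
{ intros k; exists x; unfold D; rewrite Rminus_diag, Rabs_R0; split;
    [exact Hx|apply inv_pow2_pos]. }
assert (B : forall c, below_osc Phi x c <-> forall k, Rbar_lt (q2 c) (osc_on f (D k))).
{ intros c; exact (below_osc_iff Phi f x c HP Hf Hx). }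
assert (Hmono : forall (a : R) m n, (m <= n)%nat ->
  Rbar_lt a (osc_on f (D n)) -> Rbar_lt a (osc_on f (D m))).
{ intros a m n Hmn; apply osc_on_mono; [apply Dx|].
  intros y [Hy Hy']; split; [exact Hy|]; pose proof (inv_pow2_le m n Hmn); lra. }
assert (Hdown : forall c d, q2 c <= q2 d -> below_osc Phi x d -> below_osc Phi x c).
{ intros c d Hcd Hd; apply B; intros k; specialize (proj1 (B d) Hd k).
  apply Rbar_le_lt_trans; exact Hcd. }
unfold is_osc_at; fold D.
destruct (excluded_middle_informative (exists c, ~ below_osc Phi x c)) as [[c Hc]|N].
- exists (Finite (sup_family (fun c => below_osc Phi x c) (fun c => q2 c))).
  destruct (sup_family_lub (fun c => below_osc Phi x c) (fun c => q2 c)) as [H1 H2].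
  + destruct (q2_dense (-1) 0) as [b Hb]; [lra|]; exists b; apply B; intros k.
    destruct (Dx k) as [y Hy]; apply Rbar_lt_osc_on; [exists y; exact Hy|].
    exists y, y; repeat split; try apply Hy; lra.
  + exists (q2 c); intros d Hd; apply Rnot_lt_le; intros Hlt; apply Hc.
    apply (Hdown c d); [lra|exact Hd].
  + set (s := sup_family _ _) in *; split.
    * split; intros a Ha; simpl in Ha.
      -- exists O; intros n _.
         destruct (excluded_middle_informative (exists b, below_osc Phi x b /\ a < q2 b))
           as [(b & Hb & Hab)|N].
         ++ apply (Rbar_lt_trans _ (q2 b)); [exact Hab|exact (proj1 (B b) Hb n)].
         ++ enough (s <= a) by lra; apply H2; intros b Hb; apply Rnot_lt_le; intros Hab.
            apply N; exists b; auto.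
      -- destruct (q2_dense s a Ha) as [b Hb].
         assert (Nb : ~ below_osc Phi x b) by (intros Hb'; specialize (H1 b Hb'); lra).
         rewrite B in Nb; destruct (not_all_ex_not _ _ Nb) as [k Hk].
         exists k; intros n Hn; apply (Rbar_le_lt_trans _ (q2 b)); [|exact (proj2 Hb)].
         apply Rbar_not_lt_le; intros H; apply Hk, (Hmono _ k n Hn H).
    * unfold represents_bar, osc_name; split; [|apply represents_name_of].
      destruct excluded_middle_informative as [|N]; [reflexivity|].
      destruct N; exists c; exact Hc.
- exists p_infty; split.
  + split; intros a Ha; [|destruct Ha].
    exists O; intros n _; destruct (q2_dense a (a + 1)) as [b Hb]; [lra|].
    apply (Rbar_lt_trans _ (q2 b)); [exact (proj1 Hb)|].
    apply B, NNPP; intros Nb; apply N; exists b; exact Nb.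
  + unfold represents_bar, osc_name.
    destruct excluded_middle_informative; [contradiction|reflexivity].
Qed.

Lemma osc_computable :
  exists e : nat,
    forall Phi f, fun_represents Phi f -> quasi_continuous f ->
    exists G : (nat -> nat) -> nat -> nat,
      (forall alpha n, computes e Phi [fn alpha; num n] (G alpha n)) /\
      forall alpha x, I01 x -> represents alpha x ->
        exists l : Rbar, is_osc_at f x l /\ represents_bar (G alpha) l.
Proof.
destruct (index_with_oracle 1 (fun Phi al ns => osc_name Phi (real_of al) (hd O ns))) as [e He].
{ unfold osc_name, below_osc; arithmetic_definitions; computability. }
exists e; intros Phi f HP Hf; exists (fun alpha => osc_name Phi (real_of alpha)).
split; [intros alpha n; exact (He Phi alpha [n] eq_refl)|].
intros alpha x Hx Hax; rewrite (real_of_represents alpha x Hax).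
exact (osc_name_spec Phi f x HP Hf Hx).
Qed.

Definition sup_name (Phi : operator) (p q n : nat) : nat :=
  match n with
  | O => if excluded_middle_informative (q2 q < q2 p) then 2%nat
         else if excluded_middle_informative
           (exists M, forall c, q2 p <= q2 c /\ q2 c <= q2 q -> value Phi c <= q2 M)
         then 0%nat else 1%nat
  | S n => name_of (sup_family (fun c => q2 p <= q2 c /\ q2 c <= q2 q)
                              (fun c => value Phi c)) n
  end.

(** Every point between the end points has values at rationals of the interval
    close to its own, and the end points are rational themselves. *)
Lemma Lub_rational Phi f p q :
  fun_represents Phi f -> quasi_continuous f -> I01 (q2 p) -> I01 (q2 q) ->
  Lub_Rbar (image f (fun x => q2 p <= x <= q2 q)) =
  Lub_Rbar (fun y => exists c, (q2 p <= q2 c /\ q2 c <= q2 q) /\ y = value Phi c).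
Proof.
intros HP Hf Hp Hq; apply is_lub_Rbar_unique.
destruct (Lub_Rbar_correct
  (fun y => exists c, (q2 p <= q2 c /\ q2 c <= q2 q) /\ y = value Phi c)) as [H1 H2].
set (L := Lub_Rbar _) in *.
assert (Hc : forall c, q2 p <= q2 c /\ q2 c <= q2 q -> Rbar_le (f (q2 c)) L).
{ intros c Hc; apply H1; exists c; split; [exact Hc|].
  symmetry; apply value_correct; [exact HP|unfold I01 in *; lra]. }
split.
- intros v (x & Hx & ->); simpl in Hx.
  destruct (Req_dec x (q2 p)) as [->|Np]; [apply Hc; lra|].
  destruct (Req_dec x (q2 q)) as [->|Nq]; [apply Hc; lra|].
  apply Rbar_not_lt_le; intros Hlt.
  assert (He : exists eps, 0 < eps /\ Rbar_lt L (f x - eps)).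
  { destruct L as [l| |]; simpl in *; try contradiction.
    - exists ((f x - l) / 2); lra.
    - exists 1; split; [lra|exact I]. }
  destruct He as (eps & He & HL).
  destruct (quasi_continuous_rational f x (q2 p) (q2 q) eps) as (c & _ & Hc2 & Hc3); auto;
    [unfold I01 in *; lra|lra|].
  apply Rabs_def2 in Hc3; apply (Rbar_lt_not_le _ _ HL).
  apply (Rbar_le_trans _ (f (q2 c))); [simpl; lra|apply Hc; lra].
- intros b Hb; apply H2; intros v (c & Hc' & ->); apply Hb; exists (q2 c); split; [lra|].
  apply value_correct; [exact HP|unfold I01 in *; lra].
Qed.

Lemma sup_computable :
  exists e : nat,
    forall Phi f, fun_represents Phi f -> quasi_continuous f ->
    forall p q : nat, I01 (Q2R (rat p)) -> I01 (Q2R (rat q)) ->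
    exists beta : nat -> nat,
      (forall n, computes e Phi [num p; num q; num n] (beta n)) /\
      represents_bar beta
        (Lub_Rbar (image f (fun x => Q2R (rat p) <= x <= Q2R (rat q)))).
Proof.
destruct (index_without_oracle 3 (fun Phi _ ns =>
  sup_name Phi (hd O ns) (hd O (tl ns)) (hd O (tl (tl ns))))) as [e He].
{ unfold sup_name; arithmetic_definitions; computability. }
exists e; intros Phi f HP Hf p q Hp Hq; fold (q2 p) (q2 q) in *.
exists (sup_name Phi p q); split; [intros n; exact (He Phi [p; q; n] eq_refl)|].
rewrite (Lub_rational Phi f p q HP Hf Hp Hq).
assert (Hx : forall n, sup_name Phi p q (S n) = name_of (real (Lub_Rbar (fun y =>
  exists c, (q2 p <= q2 c /\ q2 c <= q2 q) /\ y = value Phi c))) n) by reflexivity.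
set (E := fun y => exists c, (q2 p <= q2 c /\ q2 c <= q2 q) /\ y = value Phi c) in *.
destruct (Lub_Rbar_correct E) as [H1 H2].
assert (HE : forall c, q2 p <= q2 c /\ q2 c <= q2 q -> Rbar_le (value Phi c) (Lub_Rbar E)).
{ intros c Hc; apply H1; exists c; auto. }
unfold represents_bar; destruct (Lub_Rbar E) as [l| |] eqn:EL.
- split.
  + simpl; destruct excluded_middle_informative as [Hqp|_].
    * exfalso; apply (H2 m_infty); intros v (c & Hc & _); lra.
    * destruct excluded_middle_informative as [_|N]; [reflexivity|destruct N].
      destruct (q2_dense l (l + 1)) as [M HM]; [lra|].
      exists M; intros c Hc; specialize (HE c Hc); simpl in HE; lra.
  + replace (fun n => sup_name Phi p q (S n)) with (name_of l); [apply represents_name_of|].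
    apply functional_extensionality; intros n; symmetry; apply Hx.
- simpl; destruct excluded_middle_informative as [Hqp|_].
  + exfalso; apply (H2 m_infty); intros v (c & Hc & _); lra.
  + destruct excluded_middle_informative as [[M HM]|_]; [|reflexivity].
    exfalso; apply (H2 (Finite (q2 M))); intros v (c & Hc & ->); exact (HM c Hc).
- simpl; destruct excluded_middle_informative as [_|Hpq]; [reflexivity|].
  destruct (HE p); lra.
Qed.

(** * Moduli *)

(** The condition involves the oscillation near [x] and not the value at [x], so
    the modulus depends on [x] alone, also where [x] is outside the domain. *)
Definition cont_modulus (Phi : operator) (x : R) (k : nat) : nat :=
  mu (fun N => osc_le Phi (x - / 2 ^ N) (x + / 2 ^ N) (/ 2 ^ S k)).

Lemma modulus_cont_computable :
  exists e : nat,
    forall Phi f, fun_represents Phi f -> quasi_continuous f ->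
    exists (M : (nat -> nat) -> nat -> nat) (F : R -> nat -> nat),
      (forall alpha k, computes e Phi [fn alpha; num k] (M alpha k)) /\
      (forall alpha x k, represents alpha x -> M alpha k = F x k) /\
      is_modulus_cont f F.
Proof.
destruct (index_with_oracle 1 (fun Phi al ns => cont_modulus Phi (real_of al) (hd O ns)))
  as [e He].
{ unfold cont_modulus; arithmetic_definitions; computability. }
exists e; intros Phi f HP Hf.
exists (fun alpha => cont_modulus Phi (real_of alpha)), (cont_modulus Phi).
split; [intros alpha k; exact (He Phi alpha [k] eq_refl)|]; split.
- intros alpha x k H; rewrite (real_of_represents alpha x H); reflexivity.
- intros k x y Hx Hy Hxy.
  assert (H := mu_spec _ (osc_le_of_cont_set Phi f x (/ 2 ^ S k) HP Hf Hx (inv_pow2_pos _))).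
  change (mu _) with (cont_modulus Phi x k) in H; cbv beta in H.
  set (d := / 2 ^ cont_modulus Phi x k) in *.
  assert (Hd : 0 < d) by apply inv_pow2_pos.
  rewrite (osc_le_iff Phi f), inv_pow2_S in H by assumption.
  apply Rabs_def2 in Hxy; pose proof (inv_pow2_pos k).
  assert (f x - f y <= / 2 ^ k / 2) by (apply H; auto; try apply Hx; lra).
  assert (f y - f x <= / 2 ^ k / 2) by (apply H; auto; try apply Hx; lra).
  apply Rabs_def1; lra.
Qed.

(** [v] is meant to be the value at [x]; with [I01 x] as a conjunct, the least
    solution does not depend on [v] for [x] outside [[0,1]]. *)
Definition qcont_interval (Phi : operator) (x v : R) (k N m : nat) : Prop :=
  I01 x /\ 0 <= q2 (code_fst m) /\ q2 (code_fst m) < q2 (code_snd m) /\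
  q2 (code_snd m) <= 1 /\ x - / 2 ^ N <= q2 (code_fst m) /\
  q2 (code_snd m) <= x + / 2 ^ N /\
  forall c, q2 (code_fst m) < q2 c -> q2 c < q2 (code_snd m) ->
    Rabs (v - value Phi c) <= / 2 ^ S k.

Lemma qcont_interval_exists Phi f x k N :
  fun_represents Phi f -> quasi_continuous f -> I01 x ->
  exists m, qcont_interval Phi x (f x) k N m.
Proof.
intros HP Hf Hx; pose proof (inv_pow2_pos N).
destruct (quasi_continuous_interval f x (x - / 2 ^ N) (x + / 2 ^ N) (/ 2 ^ S k))
  as (c & d & Hcd & Hy); auto; [lra|apply inv_pow2_pos|].
destruct (q2_dense c d Hcd) as [r Hr].
destruct (q2_dense c (q2 r)) as [l Hl]; [lra|].
destruct (Hy (q2 l)) as (Hl1 & Hl2 & _); [lra|].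
destruct (Hy (q2 r)) as (Hr1 & Hr2 & _); [lra|].
exists (npair l r); unfold qcont_interval; rewrite code_fst_npair, code_snd_npair.
unfold I01 in Hl1, Hr1; split; [exact Hx|]; repeat split; try lra.
intros b Hb1 Hb2; destruct (Hy (q2 b)) as (Hb & _ & Hb'); [lra|].
rewrite (value_correct Phi f b HP Hb); lra.
Qed.

Lemma qcont_interval_close Phi f x k N m y :
  fun_represents Phi f -> quasi_continuous f -> qcont_interval Phi x (f x) k N m ->
  q2 (code_fst m) < y < q2 (code_snd m) -> Rabs (f x - f y) < / 2 ^ k.
Proof.
intros HP Hf (Hx & H0 & H01 & H1 & H2 & H3 & H4) Hy; pose proof (inv_pow2_pos k).
destruct (quasi_continuous_rational f y (q2 (code_fst m)) (q2 (code_snd m)) (/ 2 ^ k / 2))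
  as (c & Hc1 & Hc2 & Hc3); auto; [unfold I01; lra|lra|].
assert (H5 := H4 c (proj1 Hc2) (proj2 Hc2)).
rewrite (value_correct Phi f c HP Hc1), inv_pow2_S in H5.
apply Rabs_def2 in Hc3; apply Rabs_le_between in H5; apply Rabs_def1; lra.
Qed.

Lemma modulus_qcont_computable :
  exists e : nat,
    forall Phi f, fun_represents Phi f -> quasi_continuous f ->
    exists (M : (nat -> nat) -> nat -> nat -> nat)
           (F : R -> nat -> nat -> Q * Q),
      (forall alpha k N,
          computes e Phi [fn alpha; num k; num N] (M alpha k N)) /\
      (forall alpha x k N, represents alpha x ->
          rat_pair (M alpha k N) = F x k N) /\
      is_modulus_qcont f F.
Proof.
destruct (index_with_oracle 2 (fun Phi al ns =>
  mu (fun m => qcont_interval Phi (real_of al) (real_of (Phi al)) (hd O ns) (hd O (tl ns)) m)))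
  as [e He].
{ unfold qcont_interval; arithmetic_definitions; computability. }
exists e; intros Phi f HP Hf; eexists.
exists (fun x k N => rat_pair (mu (qcont_interval Phi x (f x) k N))).
split; [intros alpha k N; exact (He Phi alpha [k; N] eq_refl)|]; split.
- intros alpha x k N H; cbv beta; simpl hd; f_equal; apply mu_ext; intros m.
  rewrite (real_of_represents alpha x H).
  split; intros Hm; assert (Hx := proj1 Hm); assert (E := real_of_represents _ _ (HP alpha x Hx H));
    rewrite E in *; exact Hm.
- intros x k N Hx; cbv zeta; rewrite fst_rat_pair, snd_rat_pair.
  assert (H := mu_spec _ (qcont_interval_exists Phi f x k N HP Hf Hx)).
  set (m := mu _) in *; fold (q2 (code_fst m)); fold (q2 (code_snd m)).
  destruct (H) as (_ & H0 & H01 & H1 & H2 & H3 & _).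
  split; [exact H01|]; split; [intros y Hy; unfold I01; lra|]; split.
  + intros y Hy; apply Rabs_def1; lra.
  + intros y Hy; exact (qcont_interval_close Phi f x k N m y HP Hf H Hy).
Qed.

(** * Finite subcovers *)

Definition covers_grid_point (Phi : operator) (m j c : nat) : Prop :=
  I01 (q2 c) /\ Rabs (q2 (dyadic j m) - q2 c) + / 2 ^ m < value Phi c.

Definition grid_exponent (Phi : operator) : nat :=
  mu (fun m => forall j, (j <= 2 ^ m)%nat -> exists c, covers_grid_point Phi m j c).

Definition grid_centre (Phi : operator) (j : nat) : nat :=
  mu (fun c => covers_grid_point Phi (grid_exponent Phi) j c).

Definition cover_name (Phi : operator) (n : nat) : nat :=
  match n with
  | O => S (2 ^ grid_exponent Phi)
  | S i => grid_centre Phi (code_fst i)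
  end.

(** Compactness yields one [r > 0] such that every point of [[0,1]] has a point
    [x] within [f x / 4] of it, where [f x / 4 >= r].  With a rational [c] close
    to [x] for position and value, the ball at [c] contains the given point with
    the margin [2^-m < r]. *)
Lemma grid_exponent_spec Phi f j :
  fun_represents Phi f -> quasi_continuous f -> (forall x, I01 x -> 0 < f x) ->
  (j <= 2 ^ grid_exponent Phi)%nat ->
  covers_grid_point Phi (grid_exponent Phi) j (grid_centre Phi j).
Proof.
intros HP Hf Hpos Hj.
apply (mu_spec (fun c => covers_grid_point Phi (grid_exponent Phi) j c)).
revert j Hj.
apply (mu_spec (fun m => forall j, (j <= 2 ^ m)%nat -> exists c, covers_grid_point Phi m j c)).
assert (Hd : forall x, 0 < if excluded_middle_informative (I01 x) then f x / 4 else 1).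
{ intros x; destruct excluded_middle_informative as [H|]; [specialize (Hpos x H)|]; lra. }
destruct (compactness_value_1d 0 1 (fun x => mkposreal _ (Hd x))) as [r Hr].
destruct (pow2_archimedes r (cond_pos r)) as [m Hm]; exists m; intros j Hj.
assert (Hj' : I01 (q2 (dyadic j m))).
{ rewrite q2_dyadic; apply le_INR in Hj; rewrite pow_INR in Hj.
  replace (INR 2) with 2 in Hj by (simpl; lra).
  assert (H0 := pos_INR j); assert (H2 := inv_pow2_pos m); assert (H3 := pow2_pos m).
  split; [nra|].
  apply (Rmult_le_reg_r (2 ^ m)); [assumption|].
  rewrite Rmult_assoc, Rinv_l; lra. }
destruct (NNPP _ (Hr (q2 (dyadic j m)) Hj')) as (x & Hx & Hjx & Hrx).
simpl in Hjx, Hrx; destruct excluded_middle_informative as [Hx'|N]; [|contradiction].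
specialize (Hpos x Hx').
destruct (quasi_continuous_rational f x (x - f x / 4) (x + f x / 4) (f x / 4))
  as (c & Hc1 & Hc2 & Hc3); auto; try lra.
exists c; split; [exact Hc1|].
rewrite (value_correct Phi f c HP Hc1).
apply Rabs_def2 in Hc3; apply Rabs_def2 in Hjx.
assert (Rabs (q2 (dyadic j m) - q2 c) < f x / 2) by (apply Rabs_def1; lra); lra.
Qed.

Lemma grid_point_near m y : I01 y ->
  exists j, (j <= 2 ^ m)%nat /\ Rabs (y - q2 (dyadic j m)) <= / 2 ^ m.
Proof.
intros [Hy0 Hy1]; assert (H2 := pow2_pos m).
destruct (nfloor_ex (y * 2 ^ m)) as [j Hj]; [nra|].
assert (E : y = y * 2 ^ m * / 2 ^ m) by (field; lra).
assert (H3 := inv_pow2_pos m); exists j; split.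
- apply INR_le; rewrite pow_INR; replace (INR 2) with 2 by (simpl; lra).
  apply (Rle_trans _ (y * 2 ^ m)); [apply Hj|nra].
- rewrite q2_dyadic, E at 1.
  rewrite <- Rmult_minus_distr_r, Rabs_mult, (Rabs_pos_eq (/ 2 ^ m)) by lra.
  assert (Rabs (y * 2 ^ m - INR j) <= 1) by (apply Rabs_le; lra); nra.
Qed.

Lemma subcover_computable :
  exists e : nat,
    forall Phi Psi, fun_represents Phi Psi -> quasi_continuous Psi ->
    (forall x, I01 x -> 0 < Psi x) ->
    exists (beta : nat -> nat) (xs : list R),
      (forall n, computes e Phi [num n] (beta n)) /\
      represents_list beta xs /\
      (forall x, In x xs -> I01 x) /\
      (forall y, I01 y -> exists x, In x xs /\ Rabs (y - x) < Psi x).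
Proof.
destruct (index_without_oracle 1 (fun Phi _ ns => cover_name Phi (hd O ns))) as [e He].
{ unfold cover_name, grid_centre, grid_exponent, covers_grid_point;
    arithmetic_definitions; computability. }
exists e; intros Phi f HP Hf Hpos.
pose (m := grid_exponent Phi).
assert (Hg := fun j => grid_exponent_spec Phi f j HP Hf Hpos); fold m in Hg.
exists (cover_name Phi), (map (fun j => q2 (grid_centre Phi j)) (seq 0 (S (2 ^ m)))).
split; [intros n; exact (He Phi [n] eq_refl)|]; split; [split|split].
- rewrite length_map, length_seq; reflexivity.
- intros i Hi; rewrite length_map, length_seq in Hi.
  rewrite nth_indep with (d' := q2 (grid_centre Phi 0))
    by (rewrite length_map, length_seq; exact Hi).
  rewrite (map_nth (fun j => q2 (grid_centre Phi j))), seq_nth by exact Hi.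
  simpl cover_name.
  replace (fun n => grid_centre Phi (code_fst (npair i n)))
    with (fun _ : nat => grid_centre Phi i); [apply represents_const|].
  apply functional_extensionality; intros n; rewrite code_fst_npair; reflexivity.
- intros x Hx; apply in_map_iff in Hx; destruct Hx as (j & <- & Hj).
  apply in_seq in Hj; apply (Hg j); lia.
- intros y Hy; destruct (grid_point_near m y Hy) as (j & Hj & Hyj).
  exists (q2 (grid_centre Phi j)); split.
  + apply in_map_iff; exists j; split; [reflexivity|apply in_seq; lia].
  + destruct (Hg j Hj) as [Hc1 Hc2]; rewrite (value_correct Phi f _ HP Hc1) in Hc2.
    replace (y - q2 (grid_centre Phi j)) with
      ((y - q2 (dyadic j m)) + (q2 (dyadic j m) - q2 (grid_centre Phi j))) by ring.
    eapply Rle_lt_trans; [apply Rabs_triang|lra].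
Qed.

(** * Integrals at points of continuity *)

(** If [f x > 0], then by continuity [f > f x / 2] on an interval [[x, x + d]],
    which contributes a positive amount to the integral. *)
Lemma RInt_zero_cont f x :
  (forall y, I01 y -> I01 (f y)) -> ex_RInt f 0 1 -> RInt f 0 1 = 0 ->
  cont_set f x -> 0 < x < 1 -> f x = 0.
Proof.
intros Hf Hex H0 Hx Hx01; apply cont_set_eps in Hx; destruct Hx as [Hx Hc].
destruct (Rle_lt_or_eq_dec 0 (f x)) as [Hpos|E]; [apply Hf, Hx| |symmetry; exact E].
exfalso.
destruct (Hc (f x / 2)) as (r & Hr & Hy); [lra|].
pose (d := Rmin (r / 2) (Rmin x (1 - x))).
assert (D1 := Rmin_l (r / 2) (Rmin x (1 - x))).
assert (D2 := Rle_trans _ _ _ (Rmin_r (r / 2) (Rmin x (1 - x))) (Rmin_l x (1 - x))).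
assert (D3 := Rle_trans _ _ _ (Rmin_r (r / 2) (Rmin x (1 - x))) (Rmin_r x (1 - x))).
assert (Hd : 0 < d) by (repeat apply Rmin_pos; lra).
fold d in D1, D2, D3.
assert (E1 : ex_RInt f 0 x) by (apply (ex_RInt_Chasles_1 f 0 x 1); auto; lra).
assert (E2 : ex_RInt f x 1) by (apply (ex_RInt_Chasles_2 f 0 x 1); auto; lra).
assert (E3 : ex_RInt f x (x + d)) by (apply (ex_RInt_Chasles_1 f x (x + d) 1); auto; lra).
assert (E4 : ex_RInt f (x + d) 1) by (apply (ex_RInt_Chasles_2 f x (x + d) 1); auto; lra).
rewrite <- (RInt_Chasles f 0 x 1 E1 E2), <- (RInt_Chasles f x (x + d) 1 E3 E4) in H0.
assert (P1 : 0 <= RInt f 0 x) by (apply RInt_ge_0; auto; [lra|]; intros y Hy0; apply Hf; unfold I01; lra).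
assert (P2 : 0 <= RInt f (x + d) 1) by (apply RInt_ge_0; auto; [lra|]; intros y Hy0; apply Hf; unfold I01; lra).
assert (P3 : RInt (fun _ => f x / 2) x (x + d) <= RInt f x (x + d)).
{ apply RInt_le; auto; [lra|apply ex_RInt_const|].
  intros y Hy0; assert (H1 : Rabs (f y - f x) < f x / 2).
  { apply Hy; [unfold I01; lra|]; apply Rabs_def1; lra. }
  apply Rabs_def2 in H1; lra. }
rewrite RInt_const in P3; unfold plus, scal in *; simpl in *; unfold mult in *; simpl in *.
nra.
Qed.

Lemma RInt_derive_cont f x :
  ex_RInt f 0 1 -> cont_set f x -> 0 < x < 1 ->
  is_derive (fun y => RInt f 0 y) x (f x).
Proof.
intros Hex Hx Hx01; apply (is_derive_RInt f (fun y => RInt f 0 y) 0 x).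
- exists (mkposreal (Rmin x (1 - x)) ltac:(apply Rmin_pos; lra)); intros y Hy.
  apply (RInt_correct f), (ex_RInt_Chasles_1 f 0 y 1); [|exact Hex].
  apply Rabs_def2 in Hy; unfold minus, plus, opp in Hy; simpl in Hy.
  assert (H1 := Rmin_l x (1 - x)); assert (H2 := Rmin_r x (1 - x)); lra.
- apply cont_set_eps in Hx; destruct Hx as [_ Hc].
  apply filterlim_locally; intros eps.
  destruct (Hc eps (cond_pos eps)) as (r & Hr & Hy).
  exists (mkposreal (Rmin r (Rmin x (1 - x))) ltac:(repeat apply Rmin_pos; lra)).
  intros y Hyx.
  assert (D1 := Rmin_l r (Rmin x (1 - x))).
  assert (D2 := Rle_trans _ _ _ (Rmin_r r (Rmin x (1 - x))) (Rmin_l x (1 - x))).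
  assert (D3 := Rle_trans _ _ _ (Rmin_r r (Rmin x (1 - x))) (Rmin_r x (1 - x))).
  change (Rabs (y - x) < Rmin r (Rmin x (1 - x))) in Hyx.
  apply (Hy y); [|lra]; apply Rabs_def2 in Hyx; unfold I01; lra.
Qed.

Theorem theorem2p3 :
  (* (a) *)
  ((exists e : nat,
      forall Phi f, fun_represents Phi f -> quasi_continuous f ->
      exists X : (nat -> nat) -> nat,
        (forall alpha, computes e Phi [fn alpha] (X alpha)) /\
        is_char X (cont_set f)) /\
   (exists e : nat,
      forall Phi f, fun_represents Phi f -> quasi_continuous f ->
      exists (alpha : nat -> nat) (x : R),
        (forall n, computes e Phi [num n] (alpha n)) /\
        represents alpha x /\ cont_set f x)) /\
  (* (b) *)
  (exists e : nat,
     forall Phi f, fun_represents Phi f -> quasi_continuous f ->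
     exists O : nat -> nat -> nat,
       (forall n m, computes e Phi [num n; num m] (O n m)) /\
       forall x, cont_set f x <-> forall n, RM_open_set (O n) x) /\
  (* (c) *)
  (exists e : nat,
     forall Phi f, fun_represents Phi f -> quasi_continuous f ->
     exists G : (nat -> nat) -> nat -> nat,
       (forall alpha n, computes e Phi [fn alpha; num n] (G alpha n)) /\
       forall alpha x, I01 x -> represents alpha x ->
         exists l : Rbar, is_osc_at f x l /\ represents_bar (G alpha) l) /\
  (* (d) *)
  (exists e : nat,
     forall Phi f, fun_represents Phi f -> quasi_continuous f ->
     forall p q : nat, I01 (Q2R (rat p)) -> I01 (Q2R (rat q)) ->
     exists beta : nat -> nat,
       (forall n, computes e Phi [num p; num q; num n] (beta n)) /\
       represents_bar beta
         (Lub_Rbar (image f (fun x => Q2R (rat p) <= x <= Q2R (rat q))))) /\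
  (* (e) *)
  (exists e : nat,
     forall Phi f, fun_represents Phi f -> quasi_continuous f ->
     exists (M : (nat -> nat) -> nat -> nat) (F : R -> nat -> nat),
       (forall alpha k, computes e Phi [fn alpha; num k] (M alpha k)) /\
       (forall alpha x k, represents alpha x -> M alpha k = F x k) /\
       is_modulus_cont f F) /\
  (* (f) *)
  (exists e : nat,
     forall Phi f, fun_represents Phi f -> quasi_continuous f ->
     exists (M : (nat -> nat) -> nat -> nat -> nat)
            (F : R -> nat -> nat -> Q * Q),
       (forall alpha k N,
           computes e Phi [fn alpha; num k; num N] (M alpha k N)) /\
       (forall alpha x k N, represents alpha x ->
           rat_pair (M alpha k N) = F x k N) /\
       is_modulus_qcont f F) /\
  (* (g) *)
  (exists e : nat,
     forall Phi Psi, fun_represents Phi Psi -> quasi_continuous Psi ->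
     (forall x, I01 x -> 0 < Psi x) ->
     exists (beta : nat -> nat) (xs : list R),
       (forall n, computes e Phi [num n] (beta n)) /\
       represents_list beta xs /\
       (forall x, In x xs -> I01 x) /\
       (forall y, I01 y -> exists x, In x xs /\ Rabs (y - x) < Psi x)) /\
  (* (h) *)
  (exists e : nat,
     forall Phi f, fun_represents Phi f -> quasi_continuous f ->
     (forall x, I01 x -> I01 (f x)) ->
     ex_RInt f 0 1 -> RInt f 0 1 = 0 ->
     exists (alpha : nat -> nat) (x : R),
       (forall n, computes e Phi [num n] (alpha n)) /\
       represents alpha x /\ I01 x /\ f x = 0) /\
  (* (i) *)
  (exists e : nat,
     forall Phi f, fun_represents Phi f -> quasi_continuous f ->
     ex_RInt f 0 1 ->
     exists (alpha : nat -> nat) (x0 : R),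
       (forall n, computes e Phi [num n] (alpha n)) /\
       represents alpha x0 /\ 0 < x0 < 1 /\
       is_derive (fun x => RInt f 0 x) x0 (f x0)).
Proof.
destruct continuity_point_computable as [e He].
split; [split|repeat split].
- exact cont_set_computable.
- exists e; intros Phi f HP Hf.
  destruct (He Phi f HP Hf) as (alpha & x & Hc & Hr & Hx & _); exists alpha, x; auto.
- exact cont_set_RM_open.
- exact osc_computable.
- exact sup_computable.
- exact modulus_cont_computable.
- exact modulus_qcont_computable.
- exact subcover_computable.
- exists e; intros Phi f HP Hf Hf01 Hex H0.
  destruct (He Phi f HP Hf) as (alpha & x & Hc & Hr & Hx & Hx01); exists alpha, x.
  repeat split; try apply Hr; try apply Hx; auto.
  exact (RInt_zero_cont f x Hf01 Hex H0 Hx Hx01).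
- exists e; intros Phi f HP Hf Hex.
  destruct (He Phi f HP Hf) as (alpha & x & Hc & Hr & Hx & Hx01); exists alpha, x.
  split; [exact Hc|]; split; [exact Hr|]; split; [exact Hx01|].
  exact (RInt_derive_cont f x Hex Hx Hx01).
Qed.
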